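(* Let $\Delta$ and $\Delta'$ be shellable simplicial spheres. If the facet-ridge graph of $\Delta$ is isomorphic (as a graph) to the facet-ridge graph of $\Delta'$, then $\Delta$ and $\Delta'$ are isomorphic simplicial complexes, i.e., there is a bijection between their vertex sets mapping the faces of $\Delta$ exactly onto the faces of $\Delta'$. In other words, the combinatorial structure of a shellable simplicial sphere is determined by its facet-ridge graph.
   Context: A simplicial complex $\Delta$ on a finite set $V$ is a family of subsets of $V$ (faces) containing all singletons $\{v\}$, $v\in V$, and closed under taking subsets; $\dim\sigma=|\sigma|-1$. $\Delta$ is pure $(d-1)$-dimensional if all its inclusion-maximal faces (facets) have dimension $d-1$; faces of dimension $d-2$ are ridges. The facet-ridge graph of a pure $(d-1)$-dimensional complex has the facets as vertices, two facets being adjacent iff their intersection is a ridge. For a face $\sigma$, $\overline{\sigma}$ denotes the set of all subsets of $\sigma$. A shelling is a total ordering $T_1,\dots,T_n$ of the facets such that for every $2\le i\le n$, $\overline{T}_i\cap(\overline{T}_1\cup\cdots\cup\overline{T}_{i-1})$ is a pure $(d-2)$-dimensional simplicial complex; $\Delta$ is shellable if a shelling exists. A simplicial sphere is a simplicial complex whose geometric realization is homeomorphic to a sphere. *)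

(* Defs.v *)
From mathcomp Require Import all_boot all_order all_algebra.
From mathcomp Require Import all_classical all_reals all_analysis.
From mathcomp Require Import Rstruct Rstruct_topology.
Import numFieldNormedType.Exports.

Set Implicit Arguments.
Unset Strict Implicit.
Unset Printing Implicit Defensive.
Import Order.TTheory GRing.Theory Num.Theory.

Definition is_simplicial_complex (V : finType) (D : {set {set V}}) : Prop :=
  (forall v : V, [set v] \in D) /\
  (forall s t : {set V}, s \in D -> t \subset s -> t \in D).

Definition facets (V : finType) (D : {set {set V}}) : {set {set V}} :=
  [set F in D | [forall G in D, (F \subset G) ==> (G == F)]].

(* [pure D k] : D is pure of dimension k-1, i.e. every facet has k elements *)
Definition pure (V : finType) (D : {set {set V}}) (k : nat) : Prop :=
  forall F, F \in facets D -> #|F| = k.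

(* dimension + 1 of a complex: the maximal cardinality of a face *)
Definition dim1 (V : finType) (D : {set {set V}}) : nat := \max_(s in D) #|s|.

Definition is_ridge (V : finType) (D : {set {set V}}) (s : {set V}) : bool :=
  (s \in D) && (#|s|.+1 == dim1 D).

Definition fr_adj (V : finType) (D : {set {set V}}) (F G : {set V}) : bool :=
  [&& F \in facets D, G \in facets D & is_ridge D (F :&: G)].

Definition fr_graph_iso (V V' : finType) (D : {set {set V}}) (D' : {set {set V'}})
  : Prop :=
  exists phi : {set V} -> {set V'},
    [/\ {in facets D &, injective phi},
        phi @: facets D = facets D' &
        {in facets D &, forall F G, fr_adj D F G = fr_adj D' (phi F) (phi G)}].

(* The complex generated by T_1, ..., T_{i-1} intersected with that of T_i:
   all subsets of T_i contained in some earlier T_j. *)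
Definition shell_inter (V : finType) (prev : seq {set V}) (T : {set V})
  : {set {set V}} :=
  [set s : {set V} | (s \subset T) && has (fun U : {set V} => s \subset U) prev].

(* A shelling of a pure (d-1)-dimensional complex D: an ordering s of its
   facets (each exactly once) such that for every 2 <= i <= n, the complex
   \bar T_i \cap (\bar T_1 \cup ... \cup \bar T_{i-1}) is pure (d-2)-dimensional. *)
Definition shelling (V : finType) (D : {set {set V}}) (d : nat) (s : seq {set V})
  : Prop :=
  [/\ uniq s, [set x in s] = facets D &
      forall i : nat, 0 < i < size s ->
        pure (shell_inter (take i s) (nth (@finset.set0 V) s i)) d.-1].

Definition shellable (V : finType) (D : {set {set V}}) : Prop :=
  exists d : nat, pure D d /\ exists s, shelling D d s.

Local Open Scope ring_scope.
Local Open Scope classical_set_scope.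

Notation RR := Rdefinitions.R.

(* Geometric realization of D inside R^V (coordinates indexed by enum_rank):
   points with nonnegative barycentric coordinates summing to 1 whose
   support is a face of D. *)
Definition bcoord (V : finType) (x : 'rV[RR]_#|V|) (v : V) : RR :=
  x ord0 (enum_rank v).

Definition supp (V : finType) (x : 'rV[RR]_#|V|) : {set V} :=
  ([set v | bcoord x v != 0])%SET.

Definition geom_real (V : finType) (D : {set {set V}}) : set 'rV[RR]_#|V| :=
  [set x | [/\ (forall v, 0 <= bcoord x v),
              \sum_(v : V) bcoord x v = 1 &
              supp x \in D]].

Definition euclid_sphere (k : nat) : set 'rV[RR]_k.+1 :=
  [set y | \sum_(i < k.+1) (y ord0 i) ^+ 2 = 1].

Definition homeomorphic_sets (X Y : topologicalType) (A : set X) (B : set Y) : Prop :=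
  exists (f : X -> Y) (g : Y -> X),
    [/\ f @` A `<=` B, g @` B `<=` A,
        (forall x, A x -> g (f x) = x) &
        (forall y, B y -> f (g y) = y)] /\
    ({within A, continuous f} /\ {within B, continuous g}).

Definition simplicial_sphere (V : finType) (D : {set {set V}}) : Prop :=
  is_simplicial_complex D /\ exists k : nat, homeomorphic_sets (geom_real D) (@euclid_sphere k).

Definition complex_iso (V V' : finType) (D : {set {set V}}) (D' : {set {set V'}})
  : Prop :=
  exists f : V -> V',
    bijective f /\ forall s : {set V}, (s \in D) <-> (f @: s \in D').

(* Main.v *)
(* Let T_1, ..., T_n be a shelling of D, and call cell the set of facets containing a given face of
   codimension 2.

   Local structure.  Since the realization is a sphere, every ridge lies in exactly two facets: if it
   lay in one facet or in at least three, a neighbourhood of a point in its relative interior could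
   be pushed off that point, against Brouwer's theorem.  Hence every cell is a cycle of the
   facet-ridge graph, and (the shelling giving every cell a unique first facet) it has a unique local
   maximum for the shelling order.

   Counting (Joswig, Kaibel, Koerner).  The number of local maxima of all the cells of a complex on
   a given graph only depends on the graph and the order.  So D and D' have the same number of cells,
   and the cells of D' also have a unique local maximum for the shelling order of D.

   Matching.  The cells of D and D' coincide, by induction on their last facet p.  Let C, C' be the
   cells of D, D' through p and the same two earlier neighbours, C being the set of facets containing
   the face s, and assume that C' leaves the star A of some vertex x of s.  The 1-cocycle on the
   earlier facets counting the edges that leave A across the ridge opposite to a fixed vertex x' of
   D' vanishes on all earlier cells, so it is the coboundary of some u, which is constant on A.
   The facets of C' on which u takes the other value form, with the two facets of C' containing x',
   a closed part of the cycle C' avoiding p: a contradiction.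

   Once the cells agree, the bijections between the vertices of corresponding facets, induced by the
   graph isomorphism through "vertex = neighbour across the opposite ridge", agree on adjacent facets
   and glue to an isomorphism D -> D'. *)
Require Import Defs.
From mathcomp Require Import all_boot all_order all_algebra.

Set Implicit Arguments.
Unset Strict Implicit.
Unset Printing Implicit Defensive.

(** * Shellings and facet-ridge graphs *)

Notation xsum S f := (\big[addb/false]_(i in S) \big[addb/false]_(j in S) f i j).

Lemma card_sum (I : finType) (S A : {set I}) :
  #|[set i in S | i \in A]| = \sum_(i in S) (i \in A).
Proof.
rewrite -sum1_card big_mkcond [RHS]big_mkcond; apply: eq_bigr => i _.
by rewrite inE; case: (i \in S); case: (i \in A).
Qed.

Lemma xor_card (I : finType) (S : {set I}) (P : pred I) :
  \big[addb/false]_(i in S) P i = odd #|[set i in S | P i]|.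
Proof.
rewrite -sum1_card (big_morph odd oddD (erefl _)) big_mkcond [RHS]big_mkcond /=.
by apply: eq_bigr => i _; rewrite in_set; case: (i \in S); case: (P i).
Qed.

Lemma xsumD1 (I : finType) (S : {set I}) (x : I) (f : I -> I -> bool) : x \in S ->
  xsum S f = f x x (+) \big[addb/false]_(k in S :\ x) (f x k (+) f k x)
                   (+) xsum (S :\ x) f.
Proof.
move=> xS; rewrite (big_setD1 x) //= (big_setD1 x xS) /=.
under [X in _ (+) X = _]eq_bigr => i _ do rewrite (big_setD1 x xS) /=.
by rewrite !big_split /= !addbA.
Qed.

(** Modulo 2 the two terms of each unordered pair of distinct indices cancel. *)
Lemma xsum_sym (I : finType) (S : {set I}) (f : I -> I -> bool) :
  {in S, forall i, f i i = false} -> {in S &, forall i j, f i j = f j i} ->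
  xsum S f = false.
Proof.
have [n] := ubnP #|S|; elim: n S => // n IHn S leSn f0 fS.
have [->|[x xS]] := set_0Vmem S; first by rewrite big_set0.
rewrite (xsumD1 _ xS) f0 // big1 ?IHn //.
- by move: leSn; rewrite (cardsD1 x) xS.
- by move=> i /setD1P[_]; apply: f0.
- by move=> i j /setD1P[_ iS] /setD1P[_ jS]; apply: fS.
- by move=> k /setD1P[_ kS]; rewrite fS // addbb.
Qed.

(** * Families with every ridge in two facets: neighbours, stars, local maxima *)

Section Thin.
Variables (I V : finType) (T : I -> {set V}) (d : nat).

Definition adj (i j : I) := #|T i :&: T j|.+1 == d.
Definition star (s : {set V}) : {set I} := [set i | s \subset T i].
(** Closed weak pseudomanifolds. The facets are indexed by a type [I] so that two complexes with the
    same graph can share their indices. *)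
Definition thin := [/\ injective T, forall i, #|T i| = d &
  forall i (R : {set V}), R \subset T i -> #|R|.+1 = d -> #|star R| = 2].

(* The facet across the ridge [T i :\ a]; meaningless when [a] is not in [T i]. *)
Definition nb i a := odflt i [pick j | (j != i) && (T i :\ a \subset T j)].

Hypothesis thinT : thin.

Lemma adj_sym i j : adj i j = adj j i.
Proof. by rewrite /adj setIC. Qed.

Lemma adj_irr i : adj i i = false.
Proof. by case: thinT => _ h _; rewrite /adj setIid h; apply/negbTE; rewrite neq_ltn ltnSn orbT. Qed.

Lemma in_star s i : (i \in star s) = (s \subset T i).
Proof. by rewrite inE. Qed.

Lemma cardTD1 i a : a \in T i -> #|T i :\ a|.+1 = d.
Proof. by case: thinT => _ h _ ai; rewrite -(h i) (cardsD1 a (T i)) ai. Qed.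

Lemma subTT i j : T i \subset T j -> i = j.
Proof. by case: thinT => Tinj h _ ij; apply: Tinj; apply/eqP; rewrite eqEcard ij !h leqnn. Qed.

Lemma thin3 (R : {set V}) i j k : #|R|.+1 = d ->
  R \subset T i -> R \subset T j -> R \subset T k -> i != j -> i != k -> j = k.
Proof.
case: thinT => _ _ h Rd Ri Rj Rk ij ik; apply/eqP/negPn/negP => jk.
have := h i R Ri Rd; apply/eqP; rewrite neq_ltn; apply/orP; right.
have sub : [set i; j; k] \subset star R.
  by apply/subsetP => l; rewrite in_star => /setUP[/setUP[]|] /set1P->.
apply: leq_trans (subset_leq_card sub).
rewrite setUC cardsU1 cards2 ij !inE negb_or.
by rewrite [k == i]eq_sym [k == j]eq_sym ik jk.
Qed.

Lemma nbP i a : a \in T i ->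
  [/\ nb i a != i, T i :\ a \subset T (nb i a), a \notin T (nb i a)
    & T i :&: T (nb i a) = T i :\ a].
Proof.
move=> ai; case: (thinT) => _ cT /(_ i _ (subD1set _ a) (cardTD1 ai)) c2.
have [k ki ka] : exists2 k, k != i & T i :\ a \subset T k.
  have iS : i \in star (T i :\ a) by rewrite in_star subD1set.
  move: c2; rewrite (cardsD1 i) iS => -[] /eqP/cards1P[k kE].
  have := set11 k; rewrite -kE in_setD1 in_star => /andP[ki ka].
  by exists k.
rewrite /nb; case: pickP => [j /andP[ji ja]|/(_ k)]; last by rewrite ki ka.
have aj : a \notin T j.
  apply/negP => aj; move/eqP: ji; apply; apply/esym/subTT.
  by rewrite -(setD1K ai) subUset sub1set aj.
split=> //; apply/setP => x; rewrite !inE.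
have [->|xa] := eqVneq x a; first by rewrite ai (negbTE aj).
case xi: (x \in T i) => //=; apply: (subsetP ja); rewrite !inE xa //.
Qed.

Lemma adj_nb i a : a \in T i -> adj i (nb i a).
Proof. by move=> ai; case: (nbP ai) => _ _ _ e; rewrite /adj e cardTD1. Qed.

Lemma adj_neq i j : adj i j -> i != j.
Proof. by apply: contraTneq => ->; rewrite adj_irr. Qed.

Lemma adjP i j : adj i j -> exists2 a, a \in T i & j = nb i a.
Proof.
move=> ij; have [_ cT _] := thinT.
have /cards1P[a aE] : #|T i :\: T j| == 1.
  by rewrite cardsD cT; move/eqP: ij => <-; rewrite subSn ?subnn.
have := set11 a; rewrite -aE inE => /andP[aj ai]; exists a => //.
have [ni s1 _ _] := nbP ai.
have ji : j != i by rewrite eq_sym adj_neq.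
apply: (thin3 (cardTD1 ai) (subD1set _ _) _ s1); last 2 first.
- by rewrite eq_sym.
- by rewrite eq_sym.
apply/subsetP => x /setD1P[xa xi]; apply/negPn/negP => xj.
by move: xa; rewrite -in_set1 -aE inE xi xj.
Qed.

Lemma nb_inj i : {in T i &, injective (nb i)}.
Proof.
move=> a b ai bi e; have [_ _ na _] := nbP ai; have [_ s2 _ _] := nbP bi.
apply/eqP/negPn/negP => ab; case/negP: na; rewrite e; apply: (subsetP s2).
by rewrite !inE ab.
Qed.

Lemma nb_uniq i k x : adj i k -> x \in T i -> x \notin T k -> k = nb i x.
Proof.
move=> /adjP[a ai ->] xi xk; have [_ sn _ _] := nbP ai; congr nb.
by apply/eqP/negPn/negP => ax; case/negP: xk; apply: (subsetP sn); rewrite !inE eq_sym ax.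
Qed.

Lemma ridge_adj (R : {set V}) i j : #|R|.+1 = d -> R \subset T i -> R \subset T j ->
  i != j -> adj i j.
Proof.
have [_ cT _] := thinT.
move=> Rd Ri Rj ij; rewrite /adj eqn_leq -{2}Rd ltnS subset_leq_card ?subsetI ?Ri // andbT.
rewrite -(cT i) proper_card // properE subsetIl /= subsetI subxx /=.
by apply: contra ij => /subTT ->.
Qed.

Lemma nb_star s i a : i \in star s -> a \in T i -> (nb i a \in star s) = (a \notin s).
Proof.
rewrite !in_star => si ai; have [_ sn na _] := nbP ai.
apply/idP/idP => [sn'|as_]; first by apply: contra na; apply: (subsetP sn').
apply/subsetP => x xs; apply: (subsetP sn); rewrite !inE (subsetP si) // andbT.
by apply: contraNneq as_ => <-.
Qed.

Lemma star_nbrs s i : i \in star s ->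
  [set j in star s | adj i j] = nb i @: (T i :\: s).
Proof.
move=> si; apply/setP => j; rewrite inE; apply/andP/imsetP.
  move=> [js /adjP[a ai jE]]; exists a => //; rewrite !inE ai andbT.
  by rewrite -(nb_star si ai) -jE.
move=> [a /setDP[ai as_] ->]; rewrite nb_star // as_; split=> //.
exact: adj_nb.
Qed.

(** The two neighbours lie across the ridges opposite to the two vertices of [T i] outside [s]. So
    the star is a disjoint union of cycles; its connectedness will come from the shelling. *)
Lemma card_star_nbrs (s : {set V}) i : #|s|.+2 = d -> i \in star s ->
  #|[set j in star s | adj i j]| = 2.
Proof.
move=> sd si; rewrite star_nbrs // card_in_imset; last first.
  by move=> a b /setDP[ai _] /setDP[bi _]; apply: nb_inj.
have [_ cT _] := thinT.
rewrite cardsD cT (setIidPr _) -?sd -?in_star //.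
by rewrite -addn2 addKn.
Qed.

Variable ord : I -> nat.
Hypothesis ord_inj : injective ord.

(** Purity of the intersection with the earlier facets, in its usual form: each face shared with an
    earlier facet lies in a ridge shared with an earlier facet. *)
Definition shell := forall i j, ord j < ord i ->
  exists k, [/\ ord k < ord i, adj i k & T i :&: T j \subset T k].

Definition lmax s : {set I} :=
  [set i in star s | [forall k in star s, adj i k ==> (ord k < ord i)]].

Lemma lmaxP s i : reflect (i \in star s /\ forall k, k \in star s -> adj i k -> ord k < ord i)
  (i \in lmax s).
Proof.
rewrite /lmax in_set; apply: (iffP andP) => -[is_ h]; split=> //.
  by move=> k ks ik; move/forall_inP: h => /(_ k ks) /implyP; apply.
by apply/forall_inP => k ks; apply/implyP; apply: h.
Qed.

Lemma star_max_lmax s i : i \in star s -> (forall k, k \in star s -> ord k <= ord i) -> i \in lmax s.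
Proof.
move=> is_ h; apply/lmaxP; split=> // k ks ik.
by rewrite ltn_neqAle h // andbT; apply: contraTneq ik => /ord_inj ->; rewrite adj_irr.
Qed.

Lemma star_max s i : i \in star s ->
  exists2 p, p \in star s & forall k, k \in star s -> ord k <= ord p.
Proof. by move=> h; case: (arg_maxnP ord h) => p ps pm; exists p. Qed.

(** When [ord] is a shelling order, this is the restriction of the facet [T i], its smallest new
    face. *)
Definition Rset i := [set a in T i | ord (nb i a) < ord i].
Definition indeg i := #|[set j | adj i j & ord j < ord i]|.

Lemma card_Rset i : #|Rset i| = indeg i.
Proof.
rewrite /indeg; have -> : [set j | adj i j & ord j < ord i] = nb i @: Rset i.
  apply/setP => j; rewrite inE; apply/andP/imsetP.
    by move=> [/adjP[a ai ->] h]; exists a => //; rewrite inE ai.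
  by move=> [a]; rewrite inE => /andP[ai h] ->; rewrite adj_nb.
rewrite card_in_imset // => a b; rewrite !inE => /andP[ai _] /andP[bi _].
exact: nb_inj.
Qed.

(** A facet [i] is a local maximum of the star of a face [s] of codimension 2 exactly when both
    vertices of [T i] outside [s] belong to [Rset i]. The right-hand side only involves the graph
    and the order. *)
Lemma sum_lmax : \sum_(s : {set V} | #|s|.+2 == d) #|lmax s| = \sum_i 'C(indeg i, 2).
Proof.
transitivity (\sum_(s : {set V} | #|s|.+2 == d) \sum_i (i \in lmax s)).
  apply: eq_bigr => s _; rewrite -sum1_card big_mkcond.
  by apply: eq_bigr => i _; case: (i \in _).
rewrite exchange_big /=; apply: eq_bigr => i _.
rewrite -card_Rset -cards_draws.
transitivity #|[set s : {set V} | (#|s|.+2 == d) && (i \in lmax s)]|.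
  rewrite -sum1_card big_mkcond [RHS]big_mkcond.
  by apply: eq_bigr => s _; rewrite in_set; case: (_ == d) => //; case: (_ \in _).
have [_ cT _] := thinT.
have -> : [set s : {set V} | (#|s|.+2 == d) && (i \in lmax s)] =
  (fun A => T i :\: A) @: [set A : {set V} | A \subset Rset i & #|A| == 2].
  apply/setP => s; rewrite inE; apply/andP/imsetP.
    move=> [/eqP sd /lmaxP[is_ h]]; exists (T i :\: s); last first.
      rewrite in_star in is_.
      by rewrite setDDr setDv set0U (setIidPr is_).
    rewrite inE; apply/andP; split.
      apply/subsetP => a /setDP[ai as_]; rewrite inE ai h ?adj_nb //.
      by rewrite nb_star.
    by rewrite cardsD (setIidPr _) -?in_star // cT -sd -addn2 addKn.
  move=> [A]; rewrite inE => /andP[AR /eqP A2] ->.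
  have AT : A \subset T i.
    by apply: subset_trans AR _; apply/subsetP => a; rewrite inE => /andP[].
  split.
    rewrite cardsD (setIidPr AT) cT A2 -addn2 subnK //.
    by rewrite -(cT i) -A2 subset_leq_card.
  apply/lmaxP; split; first by rewrite in_star subsetDl.
  move=> k; rewrite in_star => ks /adjP[a ai kE].
  suff : a \in A by move/(subsetP AR); rewrite inE kE => /andP[].
  have [_ _ na _] := nbP ai.
  by apply: contraNT na => aA; rewrite -kE; apply: (subsetP ks); rewrite inE aA.
apply: card_in_imset => A B; rewrite !inE => /andP[AR _] /andP[BR _] e.
have RT : Rset i \subset T i by apply/subsetP => a; rewrite inE => /andP[].
have := congr1 (setD (T i)) e.
by rewrite !setDDr !setDv !set0U !(setIidPr _) // (subset_trans _ RT).
Qed.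

Hypothesis shT : shell.

Lemma star_lower s i j : i \in star s -> j \in star s -> ord j < ord i ->
  exists k, [/\ k \in star s, ord k < ord i & adj i k].
Proof.
rewrite !in_star => si sj /shT[k [ki ik sk]]; exists k; split=> //.
by rewrite in_star (subset_trans _ sk) // subsetI si.
Qed.

(** Inside a star every facet but the first has an earlier neighbour, so the facets of the star
    before position [m] form a connected graph. The induction replaces the later of the two facets
    by such a neighbour. *)
Lemma star_const s m (A : Type) (f : I -> A) :
  (forall i k, i \in star s -> k \in star s -> adj i k -> ord i < m -> ord k < m -> f i = f k) ->
  forall i j, i \in star s -> j \in star s -> ord i < m -> ord j < m -> f i = f j.
Proof.
move=> h i j; have [n] := ubnP (ord i + ord j); elim: n i j => // n IHn i j le_n.
wlog lt_ji : i j le_n / ord j < ord i.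
  move=> W si sj im jm; case: (ltngtP (ord i) (ord j)) => [ij|ji|/ord_inj -> //].
    by apply/esym/W; rewrite // addnC.
  exact: W.
move=> si sj im jm; have [k [sk ki ik]] := star_lower si sj lt_ji.
have km : ord k < m by apply: ltn_trans im.
rewrite (h i k) //; apply: IHn => //.
by rewrite -ltnS; apply: leq_trans le_n; rewrite ltnS ltn_add2r.
Qed.

(** Every facet of the cell has two neighbours in it, and only the first facet has no earlier one.
    Double counting of the edges shows that facets without later neighbour are as many as facets
    without earlier neighbour. *)
Lemma card_lmax (s : {set V}) : #|s|.+2 = d -> star s != set0 -> #|lmax s| = 1.
Proof.
move=> sd /set0Pn[x xs].
pose inn i := #|[set j in star s | adj i j & ord j < ord i]|.
pose out i := #|[set j in star s | adj i j & ord i < ord j]|.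
have io i : i \in star s -> inn i + out i = 2.
  move=> is_; rewrite -(card_star_nbrs sd is_) -cardsUI.
  rewrite (_ : _ :&: _ = set0) ?cards0 ?addn0; last first.
    by apply/setP => j; rewrite !in_set; case: (ltngtP (ord i) (ord j)); rewrite ?andbF.
  apply: eq_card => j; rewrite !in_set.
  case: (ltngtP (ord i) (ord j)); rewrite ?andbF ?andbT ?orbF //= => /ord_inj <-.
  by rewrite adj_irr !andbF.
have sumE : \sum_(i in star s) inn i = \sum_(i in star s) out i.
  transitivity (\sum_(i in star s) \sum_(j in star s) (adj i j && (ord j < ord i))).
    apply: eq_bigr => i _; rewrite /inn -sum1_card big_mkcond [RHS]big_mkcond.
    by apply: eq_bigr => j _; rewrite in_set; case: (j \in star s) => //; case: (_ && _).
  rewrite exchange_big /=; apply: eq_bigr => i _; rewrite /out -sum1_card big_mkcond [RHS]big_mkcond.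
  by apply: eq_bigr => j _; rewrite in_set adj_sym; case: (j \in star s) => //; case: (_ && _).
have lmaxE i : i \in star s -> (i \in lmax s) = (out i == 0).
  move=> is_; rewrite cards_eq0; apply/lmaxP/eqP => [[_ h]|h].
    apply/setP => j; rewrite !in_set0 in_set; apply/negbTE/negP => /and3P[js ij].
    by rewrite ltnNge ltnW // h.
  split=> // k ks ik; have := in_set0 k; rewrite -h in_set ks ik /= => /negbT.
  rewrite -leqNgt leq_eqVlt => /orP[/eqP/ord_inj ki|//].
  by rewrite ki adj_irr in ik.
have minE : \sum_(i in star s) (inn i == 0) = 1.
  case: (arg_minnP ord xs) => p ps pm.
  rewrite (big_setD1 p) //= big1 ?addn0 => [|i /setD1P[ip is_]].
    rewrite cards_eq0; case: eqP => // -[]; apply/setP => j; rewrite in_set0 in_set.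
    by apply/negbTE/negP => /and3P[js _]; rewrite ltnNge pm.
  case: (ltngtP (ord p) (ord i)) => [pi|ip'|/ord_inj e]; last by rewrite e eqxx in ip.
    have [k [ks ki ik]] := star_lower is_ ps pi.
    rewrite cards_eq0; case: eqP => // h; have := in_set0 k.
    by rewrite -h in_set ks ik ki.
  by move: (pm i is_); rewrite leqNgt ip'.
have -> : #|lmax s| = \sum_(i in star s) (out i == 0).
  transitivity (\sum_(i in star s) (i \in lmax s)); last first.
    by apply: eq_bigr => i /lmaxE ->.
  rewrite -card_sum; apply: eq_card => i.
  by rewrite in_set; case: lmaxP => [[->]|]; rewrite ?andbF.
(* As the two degrees sum to 2, adding 2 to a degree that is zero makes them equal: both become 2,
   or both are 1. *)
have : \sum_(i in star s) (inn i + ((inn i == 0) + (inn i == 0))) =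
  \sum_(i in star s) (out i + ((out i == 0) + (out i == 0))).
  apply: eq_bigr => i /io.
  by case: (inn i) (out i) => [|[|[|n]]] [|[|[|k]]].
by rewrite !big_split /= sumE => /addnI; rewrite !addnn => /double_inj <-.
Qed.


Lemma star_conn s (P : pred I) :
  (forall i k, i \in star s -> k \in star s -> adj i k -> P i -> P k) ->
  forall i k, i \in star s -> k \in star s -> P i -> P k.
Proof.
move=> h i k si sk; suff -> : P i = P k by [].
have bnd l : ord l < (\max_l' ord l').+1 by rewrite ltnS; apply: (@leq_bigmax _ ord).
apply: star_const si sk (bnd _) (bnd _) => {i k} i k si sk ik _ _.
by apply/idP/idP; apply: h; rewrite // adj_sym.
Qed.

Lemma lmax_uniq (s : {set V}) i k : #|s|.+2 = d -> i \in lmax s -> k \in star s -> k != i ->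
  ord k < ord i.
Proof.
move=> sd imax ks ki; have [is_ _] := lmaxP _ _ imax.
have s0 : star s != set0 by apply/set0Pn; exists i.
have [p ps pm] := star_max is_.
have := star_max_lmax ps pm; move/eqP/cards1P: (card_lmax sd s0) imax => [q ->].
rewrite !in_set1 => /eqP iq /eqP pq; subst p i.
by rewrite ltn_neqAle pm // andbT; apply: contraNneq ki => /ord_inj ->.
Qed.

(** The face is [T i] without the two vertices opposite to [j] and [k]. *)
Lemma pair_cell i j k : adj i j -> adj i k -> j != k ->
  exists s : {set V}, [/\ #|s|.+2 = d, i \in star s & [set l in star s | adj i l] = [set j; k]].
Proof.
move=> /adjP[a ai ->] /adjP[b bi ->] nab.
have ab : a != b by apply: contraNneq nab => ->.
exists (T i :\ a :\ b); split; last 2 first.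
- by rewrite in_star (subset_trans (subD1set _ _)) // subD1set.
- rewrite star_nbrs ?in_star ?(subset_trans (subD1set _ _)) // ?subD1set //.
  have -> : T i :\: (T i :\ a :\ b) = a |: [set b].
    apply/setP => x; rewrite !inE negb_and negbK negb_and negbK.
    have [->|xa] := eqVneq x a; first by rewrite ai orbT.
    by have [->|xb] := eqVneq x b; rewrite ?bi //= andNb.
  by rewrite imsetU1 imset_set1.
by rewrite -(cardTD1 ai) (cardsD1 b (T i :\ a)) !inE bi eq_sym ab.
Qed.

(** Vanishing of the first cohomology modulo 2 on an initial segment of the shelling. The cochain is
    the symmetrization of [w], and [xsum] is its sum around a cell. The primitive [u] is extended
    facet by facet in shelling order. *)
Lemma cocycle_exact (w : I -> I -> bool) m :
  (forall i j, w i j -> adj i j) ->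
  (forall s : {set V}, #|s|.+2 = d -> (forall i, i \in star s -> ord i < m) ->
    xsum (star s) w = false) ->
  exists u : I -> bool, forall i j, ord i < m -> ord j < m -> adj i j ->
    u i (+) u j = w i j (+) w j i.
Proof.
move=> wadj; have wF i j : adj i j = false -> w i j = false by apply: contraFF => /wadj.
elim: m => [|m IHm] wcyc; first by exists xpred0.
have [|u uP] := IHm; first by move=> s sd sm; apply: wcyc => // i /sm /ltnW.
have [i0 /eqP i0m|nom] := pickP (fun i => ord i == m); last first.
  exists u => i j; rewrite !ltnS leq_eqVlt nom => im; rewrite leq_eqVlt nom => jm.
  exact: uP.
have lt_m i : ord i < m.+1 -> i != i0 -> ord i < m.
  rewrite ltnS leq_eqVlt => /orP[/eqP|//].
  by rewrite -i0m => /ord_inj ->; rewrite eqxx.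
have [j0 /andP[aj0 j0m]|noj] := pickP (fun j => adj i0 j && (ord j < m)); last first.
  exists u => i j im jm ij.
  have [e|/(lt_m _ im) im'] := eqVneq i i0.
    subst i; move: (noj j); rewrite ij /= => /negbT.
    by rewrite lt_m // eq_sym adj_neq.
  have [e|/(lt_m _ jm) jm'] := eqVneq j i0; last exact: uP.
  by subst j; move: (noj i); rewrite adj_sym ij im'.
pose W i j := w i j (+) w j i.
(* The value forced at the new facet [i0] does not depend on the earlier neighbour [j]: [i0] is the
   last facet of the cell through [j], [i0] and [j0], where the cocycle condition is available. *)
have key j : adj i0 j -> ord j < m -> u j0 (+) W i0 j0 = u j (+) W i0 j.
  move=> aj jm; have [-> //|jj0] := eqVneq j j0.
  have [s [sd si0 sE]] := pair_cell aj aj0 jj0.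
  have i0max : i0 \in lmax s.
    apply/lmaxP; split=> // k ks ik; have : k \in [set j; j0] by rewrite -sE inE ks.
    by rewrite i0m => /set2P[->|->].
  have sm k : k \in star s -> ord k < m.+1.
    move=> ks; have [->|/(lmax_uniq sd i0max ks)] := eqVneq k i0; first by rewrite i0m.
    by rewrite i0m => /ltnW.
  have sm' k : k \in star s :\ i0 -> ord k < m by move=> /setD1P[ki ks]; apply/lt_m/ki/sm.
  have := wcyc s sd sm; rewrite (xsumD1 _ si0) /=.
  rewrite (wF _ _ (adj_irr i0)).
  have pick2 (f : I -> bool) : \big[addb/false]_(k in star s :\ i0) (adj i0 k && f k) = f j (+) f j0.
    have inS k : k \in [set j; j0] -> k \in star s :\ i0.
      by rewrite -sE in_set => /andP[ks ik]; rewrite in_setD1 ks eq_sym adj_neq.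
    rewrite (big_setD1 j) ?inS ?set21 //= aj (big_setD1 j0) ?big1 ?aj0 ?addbF //=.
    - by rewrite addbF.
    - move=> k /setD1P[kj0 /setD1P[kj /setD1P[_ ks]]]; apply/negbTE/negP => /andP[ik _].
      have : k \in [set j; j0] by rewrite -sE in_set ks.
      by rewrite !inE (negbTE kj0) (negbTE kj).
    - by rewrite in_setD1 eq_sym jj0 inS ?set22.
  have sumW : \big[addb/false]_(k in star s :\ i0) W i0 k = W i0 j (+) W i0 j0.
    rewrite -pick2; apply: eq_bigr => k _; rewrite /W.
    case ik: (adj i0 k) => //=.
    by rewrite !wF // adj_sym.
  rewrite -/(W _ _) sumW.
  (* Away from [i0] the coboundary of [u] may replace [w], because the difference of the summands is
     symmetric in the two facets. *)
  have -> : xsum (star s :\ i0) w = xsum (star s :\ i0) (fun a b => adj a b && u a).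
    apply/eqP; rewrite -negb_add -big_split /=; apply/negbT.
    under eq_bigr => a _ do rewrite -big_split /=.
    apply: xsum_sym => [a _|a b /sm' am /sm' bm].
      by rewrite wF ?adj_irr.
    case ab: (adj a b); rewrite adj_sym in ab; rewrite ab /=.
      have := uP a b am bm; rewrite adj_sym ab => /(_ isT).
      by case: (u a) (u b) (w a b) (w b a) => [] [] [] [].
    by rewrite !wF // adj_sym.
  (* The value [u a] is counted once for each neighbour of [a] in the cell other than [i0]: an odd
     number of times exactly when [a] is adjacent to [i0]. *)
  have -> : xsum (star s :\ i0) (fun a b => adj a b && u a) = u j (+) u j0.
    rewrite -pick2; apply: eq_bigr => a /setD1P[_ as_].
    have xorF b c : b (+) c = false -> b = c by case: b c => [] [].
    have := congr1 odd (card_star_nbrs sd as_).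
    rewrite -xor_card (big_setD1 _ si0) /= adj_sym => /xorF ->; case: (u a); last first.
      by rewrite andbF big1 // => b _; rewrite andbF.
    by rewrite andbT; apply: eq_bigr => b _; rewrite andbT.
  by case: (u j) (u j0) (W i0 j) (W i0 j0) => [] [] [] [].
exists (fun i => if i == i0 then u j0 (+) W i0 j0 else u i) => i j im jm ij.
have [e|ni] := eqVneq i i0; have [e'|nj] := eqVneq j i0.
- by rewrite e e' adj_irr in ij.
- subst i; rewrite (key j) ?lt_m //; rewrite /W.
  by case: (u j) (w i0 j) (w j i0) => [] [] [].
- subst j; rewrite (key i) ?lt_m 1?adj_sym //; rewrite /W.
  by case: (u i) (w i0 i) (w i i0) => [] [] [].
by apply: uP => //; apply: lt_m.
Qed.

End Thin.

(** * Counting cells by local maxima *)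

Section TwoThin.
Variables (I V V' : finType) (T : I -> {set V}) (T' : I -> {set V'}) (d : nat).
Hypotheses (thinT : thin T d) (thinT' : thin T' d).
Hypothesis adjE : forall i j, adj T d i j = adj T' d i j.

Lemma indegE ord i : indeg T d ord i = indeg T' d ord i.
Proof. by apply: eq_card => j; rewrite !inE adjE. Qed.

Definition cells (W : finType) (S : I -> {set W}) : {set {set W}} :=
  [set s : {set W} | (#|s|.+2 == d) && (star S s != set0)].

Lemma sum_lmax_cells (W : finType) (S : I -> {set W}) ord :
  \sum_(s : {set W} | #|s|.+2 == d) #|lmax S d ord s| = \sum_(s in cells S) #|lmax S d ord s|.
Proof.
rewrite big_mkcond [RHS]big_mkcond; apply: eq_bigr => s _; rewrite in_set.
case: (_ == d) => //=; case: eqP => //= s0; apply/eqP; rewrite cards_eq0 -subset0 -s0.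
by apply/subsetP => i /lmaxP[].
Qed.

Lemma card_cells ord : injective ord -> shell T d ord ->
  #|cells T| = \sum_i 'C(indeg T d ord i, 2).
Proof.
move=> oi sh; rewrite -sum_lmax // sum_lmax_cells -sum1_card.
by apply: eq_bigr => s; rewrite in_set => /andP[/eqP sd s0]; rewrite card_lmax.
Qed.

(** For any order, the last facet of a cell is a local maximum of it. *)
Lemma card_cells_ge ord : injective ord ->
  #|cells T'| <= \sum_i 'C(indeg T' d ord i, 2)
    ?= iff [forall (s | s \in cells T'), 1 == #|lmax T' d ord s|].
Proof.
move=> oi; rewrite -sum_lmax // sum_lmax_cells -sum1_card.
apply: leqif_sum => s; rewrite in_set => /andP[_ /set0Pn[i is_]].
split=> //; have [p ps pm] := star_max ord is_.
by rewrite (cardsD1 p) (star_max_lmax thinT' oi ps pm).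
Qed.

End TwoThin.

(** * Matching the cells of two complexes with the same graph *)

Section Match.
Variables (I V V' : finType) (T : I -> {set V}) (T' : I -> {set V'}) (d : nat).
Hypotheses (thinT : thin T d) (thinT' : thin T' d).
Hypothesis adjE : forall i j, adj T d i j = adj T' d i j.
Variables (ord ord' : I -> nat).
Hypotheses (ord_inj : injective ord) (ord_inj' : injective ord').
Hypotheses (shT : shell T d ord) (shT' : shell T' d ord').

(** The cells of [T'] are at most as many as the local maxima for [ord], which are as many as the
    cells of [T]; these are at most as many as the local maxima for [ord'], hence as the cells of
    [T']. So equality holds throughout. *)
Lemma lmax_transfer (s : {set V'}) : #|s|.+2 = d -> star T' s != set0 ->
  #|lmax T' d ord s| = 1.
Proof.
have adjE' i j : adj T' d i j = adj T d i j by rewrite adjE.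
move=> sd s0; have [le1 eq1] := card_cells_ge thinT' ord_inj.
have [le2 _] := card_cells_ge thinT ord_inj'.
have cE : #|cells d T'| == \sum_i 'C(indeg T' d ord i, 2).
  rewrite eqn_leq le1 /=.
  rewrite -(eq_bigr _ (fun i _ => congr1 (fun n => 'C(n, 2)) (indegE adjE ord i))).
  rewrite -(card_cells thinT ord_inj shT) (card_cells thinT' ord_inj' shT').
  by rewrite (eq_bigr _ (fun i _ => congr1 (fun n => 'C(n, 2)) (indegE adjE' ord' i))).
rewrite cE in eq1; move/esym/forall_inP: eq1 => /(_ s).
by rewrite in_set sd eqxx s0 => /(_ isT)/eqP <-.
Qed.

(** The cocycle condition of [cocycle_exact] on a matched cell. If [x] is outside [s], the facets of
    the cell containing [x] are none or two. Each has one edge of the cell on which [x] disappears,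
    and [x'] disappears on both of these edges or on neither. *)
Lemma cell_even (s : {set V}) (s' : {set V'}) x x' :
  #|s|.+2 = d -> #|s'|.+2 = d -> star T s = star T' s' ->
  xsum (star T s) (fun t y => [&& adj T d t y, x \in T t, x \notin T y, x' \in T' t & x' \notin T' y])
    = false.
Proof.
move=> sd sd' ss'; have [xs|xs] := boolP (x \in s).
  apply: big1 => t _; apply: big1 => y; rewrite in_star => /subsetP/(_ x xs) ->.
  by rewrite !andbF.
have xsd : #|x |: s|.+1 = d by rewrite cardsU1 xs.
have inner t : t \in star T (x |: s) ->
  \big[addb/false]_(y in star T s) [&& adj T d t y, x \in T t, x \notin T y, x' \in T' t & x' \notin T' y]
   = (x' \in T' t) && (x' \notin T' (nb T t x)).
  rewrite in_star subUset sub1set => /andP[xt st].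
  have [_ _ xn _] := nbP thinT xt.
  have ns : nb T t x \in star T s by rewrite (nb_star thinT) // in_star.
  rewrite (big_setD1 _ ns) /= big1 ?addbF; first by rewrite (adj_nb thinT xt) xt xn.
  move=> y /setD1P[yn _]; apply/negbTE; apply: contra yn => /and3P[ty _ /andP[xy _]].
  by rewrite (nb_uniq thinT ty xt xy).
(* If [x'] were lost on the edge at [t0] only, then [t1] would be the neighbour of [t0] opposite to
   [x'], which avoids [x], or else the ridge [x' |: s'] would lie in the three facets [t0], [t1] and
   [nb T t1 x]. *)
have imp t0 t1 : t0 \in star T (x |: s) -> t1 \in star T (x |: s) -> t0 != t1 ->
  (x' \in T' t0) && (x' \notin T' (nb T t0 x)) -> (x' \in T' t1) && (x' \notin T' (nb T t1 x)).
  rewrite !in_star => h0 h1 t01 /andP[x0 xn0].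
  have a01 : adj T' d t0 t1 by rewrite -adjE; apply: (ridge_adj thinT xsd).
  move: h0 h1; rewrite !subUset !sub1set => /andP[xt0 st0] /andP[xt1 st1].
  have [_ _ xy0 _] := nbP thinT xt0; have [ny1 _ xy1 _] := nbP thinT xt1.
  have ay0 : adj T' d t0 (nb T t0 x) by rewrite -adjE (adj_nb thinT).
  have x1 : x' \in T' t1.
    apply/negPn/negP => x1; case/negP: xy0.
    by rewrite (nb_uniq thinT' ay0 x0 xn0) -(nb_uniq thinT' a01 x0 x1).
  rewrite x1 /=; apply/negP => xn1.
  have sub i : s \subset T i -> s' \subset T' i by rewrite -!in_star ss'.
  have s'y0 : s' \subset T' (nb T t0 x) by apply: sub; rewrite -in_star (nb_star thinT) ?in_star.
  have s'y1 : s' \subset T' (nb T t1 x) by apply: sub; rewrite -in_star (nb_star thinT) ?in_star.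
  have xs' : x' \notin s' by apply: contra xn0; apply: subsetP.
  have Rd : #|x' |: s'|.+1 = d by rewrite cardsU1 xs'.
  case/negP: xy1; rewrite -(@thin3 _ _ _ _ thinT' (x' |: s') t1 t0 (nb T t1 x)) //.
  - by rewrite subUset sub1set x1 sub.
  - by rewrite subUset sub1set x0 sub.
  - by rewrite subUset sub1set xn1.
  - by rewrite eq_sym.
  - by rewrite eq_sym.
have [s0|[i iS]] := set_0Vmem (star T (x |: s)).
  apply: big1 => t ts; apply: big1 => y _; apply/negbTE/negP => /and3P[_ xt _].
  by have := in_set0 t; rewrite -s0 in_star subUset sub1set xt -in_star ts.
have [_ _ /(_ i (x |: s))] := thinT; rewrite -in_star iS => /(_ isT xsd).
rewrite (cardsD1 i) iS => -[] /eqP/cards1P[k kE].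
have := set11 k; rewrite -kE => /setD1P[ki kS].
have sub t : t \in star T (x |: s) -> t \in star T s.
  by rewrite !in_star subUset => /andP[].
have kS' : k \in star T s :\ i by rewrite in_setD1 ki sub.
set g := (X in \big[addb/false]_(t in star T s) X t).
rewrite (big_setD1 i (sub _ iS)) (big_setD1 k kS') big1 /= => [|t /setD1P[tk /setD1P[ti ts]]].
  rewrite {}/g !inner // addbF.
  have e : (x' \in T' i) && (x' \notin T' (nb T i x)) = (x' \in T' k) && (x' \notin T' (nb T k x)).
    by apply/idP/idP; apply: imp; rewrite // eq_sym.
  by rewrite e addbb.
apply: big1 => y _; apply/negbTE/negP => /and3P[_ xt _].
have : t \in [set k] by rewrite -kE in_setD1 ti in_star subUset sub1set xt -in_star ts.
by rewrite in_set1 (negbTE tk).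
Qed.

Lemma cell_step (s : {set V}) p : #|s|.+2 = d -> p \in star T s ->
  (forall k, k \in star T s -> ord k <= ord p) ->
  (forall m : {set V}, #|m|.+2 = d -> star T m != set0 ->
     (forall i, i \in star T m -> ord i < ord p) ->
     exists2 m' : {set V'}, #|m'|.+2 = d & star T m = star T' m') ->
  exists2 s' : {set V'}, #|s'|.+2 = d & star T s = star T' s'.
Proof.
move=> sd ps pmax IH.
have /lmaxP[_ pnb] := star_max_lmax thinT ord_inj ps pmax.
have /cards2P[j [k [jk jkE]]] : #|[set l in star T s | adj T d p l]| == 2.
  by rewrite (card_star_nbrs thinT).
have injk l : l \in [set j; k] -> [/\ l \in star T s, adj T d p l & ord l < ord p].
  by rewrite -jkE in_set => /andP[ls pl]; rewrite ls pl pnb.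
have [js pj jp] := injk j (set21 _ _); have [ks pk kp] := injk k (set22 _ _).
(* The candidate is the cell of [T'] through [p] and its two neighbours [j], [k] in the cell of
   [s]. *)
have [|||s' [sd' ps' s'E]] := pair_cell thinT' (i:=p) (j:=j) (k:=k); rewrite -?adjE //.
exists s' => //.
(* Both neighbours of [p] in the new cell are earlier, so [p] is a local maximum, by [lmax_transfer]
   the only one, hence the last facet. *)
have C'lt q : q \in star T' s' -> q != p -> ord q < ord p.
  have s'0 : star T' s' != set0 by apply/set0Pn; exists p.
  have [r rs rm] := star_max ord ps'; have rmax := star_max_lmax thinT' ord_inj rs rm.
  have pmax' : p \in lmax T' d ord s'.
    apply/lmaxP; split=> // l ls pl.
    by have [] := injk l; rewrite // -s'E in_set ls.
  move/eqP/cards1P: (lmax_transfer sd' s'0) => [z zE].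
  move: rmax pmax'; rewrite zE !in_set1 => /eqP rz /eqP pz; subst r z => qs qp.
  by rewrite ltn_neqAle rm // andbT; apply: contraNneq qp => /ord_inj ->.
have nbp q : q \in star T' s' -> adj T d p q -> q \in [set j; k].
  by rewrite adjE => qs pq; rewrite -s'E in_set qs.
(* One inclusion suffices: both cells are 2-regular and the cell of [s] is connected. *)
suff sub x : x \in s -> forall i, i \in star T' s' -> x \in T i.
  have subC : star T' s' \subset star T s.
    by apply/subsetP => i is'; rewrite in_star; apply/subsetP => x /sub; apply.
  apply/eqP; rewrite eqEsubset subC andbT; apply/subsetP => i is_.
  apply: (star_conn ord_inj shT (P := fun i => i \in star T' s') _ ps is_ ps') => {i is_} i l is_ ls il is'.
  have : l \in [set l in star T s | adj T d i l] by rewrite in_set ls.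
  suff <- : [set l in star T' s' | adj T' d i l] = [set l in star T s | adj T d i l].
    by rewrite in_set => /andP[].
  apply/eqP; rewrite eqEcard (card_star_nbrs thinT) ?(card_star_nbrs thinT') // leqnn andbT.
  apply/subsetP => z; rewrite !in_set => /andP[zs iz].
  by rewrite adjE iz andbT -in_star (subsetP subC) // in_star.
move=> xs y0 y0s; apply/negPn/negP => xy0.
have pA : x \in T p by move: ps; rewrite in_star => /subsetP; apply.
have jA : x \in T j by move: js; rewrite in_star => /subsetP; apply.
have kA : x \in T k by move: ks; rewrite in_star => /subsetP; apply.
(* The new cell is connected and [p] contains [x], so some edge of it, from [q] to [a], leaves the
   star of [x]. *)
have [q [a [qs as_ qa qA aA]]] : exists q a, [/\ q \in star T' s', a \in star T' s',
    adj T d q a, x \in T q & x \notin T a].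
  have [/exists_inP[q qs /exists_inP[a as_ /and3P[qa qA aA]]]|no] := boolP
    [exists q in star T' s', [exists a in star T' s', [&& adj T d q a, x \in T q & x \notin T a]]].
    by exists q, a.
  case/negP: xy0; have := star_conn ord_inj' shT' (P := fun i => x \in T i) _ ps' y0s pA.
  apply=> i l is' ls' il iA; apply/negPn/negP => lA; case/negP: no.
  by apply/exists_inP; exists i => //; apply/exists_inP; exists l; rewrite // adjE il iA.
have qp : q != p.
  apply: contraNneq aA => qp; subst q; have [] := injk a (nbp a as_ qa).
  by rewrite in_star => /subsetP sub _ _; apply: sub.
have qlt := C'lt q qs qp.
have ap : a != p by apply: contraNneq aA => ->.
have alt := C'lt a as_ ap.
have [x' x'q aE] := adjP thinT' (etrans (esym (adjE q a)) qa).
have [_ _ x'a _] := nbP thinT' x'q; rewrite -aE in x'a.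
(* The edges leaving both the star of [x] and, in the other complex, the star of [x'], the vertex
   lost from [q] to [a]. Before [p] they give a cocycle, by [cell_even] on the cells matched so
   far. *)
pose w t y := [&& adj T d t y, x \in T t, x \notin T y, x' \in T' t & x' \notin T' y].
have [||u uP] := cocycle_exact thinT ord_inj shT (w := w) (m := ord p).
- by move=> t y /and3P[].
- move=> m md mlt; have [m0|m0] := eqVneq (star T m) set0; first by rewrite m0 big_set0.
  have [m' md' mE] := IH m md m0 mlt.
  exact: (cell_even x x' md md' mE).
(* No edge inside the star of [x] is counted by [w], and the part of this star before [p] is
   connected. *)
have uA i : x \in T i -> ord i < ord p -> u i = u j.
  move=> iA ip; apply: (star_const ord_inj shT (s := [set x]) (m := ord p)) => //;
    rewrite ?in_star ?sub1set // => {i iA ip} i l; rewrite !in_star !sub1set => iA lA il ip lp.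
  have := uP i l ip lp il; rewrite /w iA lA /= !andbF /=.
  by case: (u i) (u l) => [] [].
pose U := [set y in star T' s' | (y != p) && (u y != u j)].
have UP y : y \in U -> [/\ y \in star T' s', y != p, ord y < ord p, u y = ~~ u j & x \notin T y].
  rewrite in_set => /and3P[ys yp uy]; have yl := C'lt y ys yp; split=> //.
    by move: uy; case: (u y) (u j) => [] [].
  by apply: contra uy => yA; rewrite uA.
have aU : a \in U.
  rewrite in_set as_ ap /=; have := uP q a qlt alt qa.
  rewrite /w qa qA (negbTE aA) x'q x'a /= !andbF (uA q) //=.
  by case: (u a) (u j) => [] [].
(* As [u] changes along this edge and [y] avoids [x], the edge from [t] to [y] is counted by [w].
   Here [t] is not [p], whose neighbours [j] and [k] in the cell contain [x]. *)
have cut t y : t \in star T' s' -> t \notin U -> y \in U -> adj T' d t y ->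
    [/\ t != p, x' \in T' t & x' \notin T' y].
  move=> ts tU yU ty; have [ys yp yl uy yA] := UP y yU.
  have tp : t != p.
    apply: contraNneq yA => tp; subst t; rewrite -adjE in ty.
    have [] := injk y (nbp y ys ty); rewrite in_star => /subsetP sub _ _; exact: sub.
  have tl := C'lt t ts tp.
  have ut : u t = u j by move: tU; rewrite in_set ts tp /= negbK => /eqP.
  have := uP t y tl yl; rewrite adjE => /(_ ty).
  rewrite ut uy /w (negbTE yA) /= !andbF addbF.
  by case: (u j) => /= /esym/and4P[].
have qU : q \notin U by rewrite in_set qs qp /= negbK uA.
have s'T i : i \in star T' s' -> s' \subset T' i by rewrite in_star.
have x's' : x' \notin s' by apply: contra x'a => /(subsetP (s'T a as_)).
have Rd : #|x' |: s'|.+1 = d by rewrite cardsU1 x's'.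
have RT i : i \in star T' s' -> x' \in T' i -> x' |: s' \subset T' i.
  by move=> is_ ix; rewrite subUset sub1set ix s'T.
(* In a 2-regular graph the edges between a set and its complement are even in number. Since [q] has
   only the edge to [a] into [U], another facet [b] has an edge into [U]. *)
have [b [y2 [bs bU bq y2U by2]]] : exists b y2,
    [/\ b \in star T' s', b \notin U, b != q, y2 \in U & adj T' d b y2].
  pose f t := \big[addb/false]_(y in U) adj T' d t y.
  have subU : U \subset star T' s' by apply/subsetP => y /UP[].
  have even_cut : \big[addb/false]_(t in star T' s' :\: U) f t = false.
    have : \big[addb/false]_(t in star T' s') f t = false.
      rewrite exchange_big /=; apply: big1 => y /UP[ys _ _ _ _].
      under eq_bigr => t _ do rewrite adj_sym.
      by rewrite xor_card (card_star_nbrs thinT').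
    rewrite (big_setID U) /= (setIidPr subU) xsum_sym //.
      by move=> i _; apply: adj_irr.
    by move=> i l _ _; apply: adj_sym.
  have fq : f q = true.
    rewrite /f (big_setD1 a aU) /= big1 => [|y /setD1P[ya yU]].
      by rewrite -adjE qa.
    apply/negbTE; apply: contra ya => qy; have [_ _ xy] := cut q y qs qU yU qy.
    by rewrite aE (nb_uniq thinT' qy x'q xy).
  have qD : q \in star T' s' :\: U by rewrite in_setD qU qs.
  have [b /andP[/setD1P[bq /setDP[bs bU]] fb]|no] :=
    pickP (fun b => (b \in (star T' s' :\: U) :\ q) && f b).
    have [y2 /andP[y2U by2]|no] := pickP (fun y => (y \in U) && adj T' d b y).
      by exists b, y2.
    by move: fb; rewrite /f big1 // => y yU; have := no y; rewrite yU.
  move: even_cut; rewrite (big_setD1 q qD) /= fq big1 // => t tD.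
  by have := no t; rewrite tD.
have [bp x'b x'y2] := cut b y2 bs bU y2U by2.
have y2E : y2 = nb T' b x' by apply: (nb_uniq thinT').
have qb3 t : t \in star T' s' -> x' \in T' t -> t != q -> t = b.
  move=> ts tx tq; apply/esym/(thin3 thinT' Rd (i := q)); rewrite ?RT //; by rewrite eq_sym.
(* The ridge [x' |: s'] lies in [q] and [b] only, so [U] together with [q] and [b] is closed under
   adjacency in the cell. Connectedness would then put [p] in it. *)
have := star_conn ord_inj' shT' (P := fun i => [|| i \in U, i == q | i == b]) _ qs ps'.
rewrite eqxx orbT => /(_ _ isT).
rewrite in_set eqxx andbF eq_sym (negbTE qp) eq_sym (negbTE bp) /=; move=> h; apply: notF; apply: h.
move=> i l is_ ls il /or3P[iU|/eqP iq|/eqP ib].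
- have [//|lU] := boolP (l \in U); rewrite adj_sym in il.
  have [lp x'l _] := cut l i ls lU iU il.
  by have [//|lq] := eqVneq l q; rewrite (qb3 l) ?eqxx ?orbT.
- subst i; have [x'l|x'l] := boolP (x' \in T' l); last first.
    by rewrite (nb_uniq thinT' il x'q x'l) -aE aU.
  by rewrite (qb3 l) ?eqxx ?orbT // eq_sym (adj_neq thinT' il).
- subst i; have [x'l|x'l] := boolP (x' \in T' l); last first.
    by rewrite (nb_uniq thinT' il x'b x'l) -y2E y2U.
  by have [|lq] := eqVneq l q; rewrite ?orbT // (qb3 l) ?eqxx ?orbT.
Qed.

(** Strong induction on the position of the last facet of the cell. *)
Lemma cell_match (s : {set V}) : #|s|.+2 = d -> star T s != set0 ->
  exists2 s' : {set V'}, #|s'|.+2 = d & star T s = star T' s'.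
Proof.
suff H n (m : {set V}) : #|m|.+2 = d -> star T m != set0 ->
    (forall i, i \in star T m -> ord i < n) ->
    exists2 m' : {set V'}, #|m'|.+2 = d & star T m = star T' m'.
  by move=> sd s0; apply: (H (\max_i ord i).+1) => // i _; rewrite ltnS (@leq_bigmax _ ord).
elim: n m => [|n IHn] m md m0 mn; first by have /set0Pn[i /mn] := m0.
have /set0Pn[i im] := m0; have [p pm pmax] := star_max ord im.
apply: (cell_step md (p := p)) => // m1 md1 m10 m1lt; apply: IHn => // k /m1lt km.
exact: leq_trans km (mn p pm).
Qed.

(** A vertex of a facet is recognised by the neighbour opposite to it. The facets [nb T i v], [i],
    [j], [nb T j v] are consecutive in the cell of [T i :\ a :\ v]. In the matched cell the ridge
    between [i] and [j] is [v' |: s'], so going on from [j] loses [v']. *)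
Lemma label_transport i j v v' : adj T d i j -> v \in T i -> v \in T j ->
  v' \in T' i -> nb T' i v' = nb T i v -> v' \in T' j /\ nb T' j v' = nb T j v.
Proof.
move=> ij vi vj v'i nbv; have [a ai jE] := adjP thinT ij.
have [_ _ aj _] := nbP thinT ai; rewrite -jE in aj.
have va : v != a by apply: contraNneq aj => <-.
have sd : #|T i :\ a :\ v|.+2 = d by rewrite -(cardTD1 thinT ai) (cardsD1 v (T i :\ a)) !inE vi va.
have is_ : i \in star T (T i :\ a :\ v).
  by rewrite in_star (subset_trans (subD1set _ _)) // subD1set.
have js : j \in star T (T i :\ a :\ v) by rewrite jE (nb_star thinT) // !inE eqxx andbF.
have nis : nb T i v \in star T (T i :\ a :\ v) by rewrite (nb_star thinT) // !inE eqxx.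
have njs : nb T j v \in star T (T i :\ a :\ v) by rewrite (nb_star thinT) // !inE eqxx.
have s0 : star T (T i :\ a :\ v) != set0 by apply/set0Pn; exists i.
have [s' sd' sE] := cell_match sd s0.
move: is_ js nis njs; rewrite sE !in_star => is_ js nis njs.
have [_ _ vn _] := nbP thinT vi; have [_ _ vnj _] := nbP thinT vj.
have [_ _ v'n _] := nbP thinT' v'i; rewrite nbv in v'n.
have ij' : adj T' d i j by rewrite -adjE.
have v'j : v' \in T' j.
  apply/negPn/negP => v'j; case/negP: vn.
  by rewrite -nbv -(nb_uniq thinT' ij' v'i v'j).
split=> //; have [v'y|v'y] := boolP (v' \in T' (nb T j v)); last first.
  by rewrite -(nb_uniq thinT' _ v'j v'y) // -adjE (adj_nb thinT).
have v's : v' \notin s' by apply: contra v'n; apply: subsetP.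
have Rd : #|v' |: s'|.+1 = d by rewrite cardsU1 v's.
case/negP: vnj; rewrite -(@thin3 _ _ _ _ thinT' (v' |: s') j i (nb T j v)) //.
- by rewrite subUset sub1set v'j.
- by rewrite subUset sub1set v'i.
- by rewrite subUset sub1set v'y.
- by rewrite eq_sym (adj_neq thinT).
- by rewrite (adj_neq thinT) // (adj_nb thinT).
Qed.

(** By [label_transport] the image of [v] is the same for adjacent facets containing [v], and the
    star of a vertex is connected thanks to the shelling. *)
Lemma vertex_map (cover : forall v, exists i, v \in T i) :
  exists f : V -> V', forall i v, v \in T i -> f v \in T' i /\ nb T' i (f v) = nb T i v.
Proof.
have ex v : exists v', forall i, v \in T i -> (v' \in T' i) && (nb T' i v' == nb T i v).
  have [i vi] := cover v.
  have [v' v'i nE] : exists2 v', v' \in T' i & nb T i v = nb T' i v'.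
    by apply: (adjP thinT'); rewrite -adjE (adj_nb thinT).
  exists v' => k vk.
  have h l : (l \in star T [set v]) = (v \in T l) by rewrite in_star sub1set.
  apply: (star_conn ord_inj shT (s := [set v]) (P := fun l => (v' \in T' l) && (nb T' l v' == nb T l v))
     _ (i := i)); rewrite ?h ?v'i ?nE ?eqxx // => a b; rewrite !h => va vb ab /andP[v'a /eqP na].
  by have [-> ->] := label_transport ab va vb v'a na; rewrite eqxx.
have ex' v : exists v', [forall i, (v \in T i) ==> (v' \in T' i) && (nb T' i v' == nb T i v)].
  by have [v' h] := ex v; exists v'; apply/forallP => i; apply/implyP/h.
exists (fun v => xchoose (ex' v)) => i v vi.
by have /forallP/(_ i) := xchooseP (ex' v); rewrite vi => /andP[-> /eqP].
Qed.

End Match.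

(** The vertex maps in both directions preserve the neighbour across the opposite ridge, which
    determines a vertex of a given facet; hence they are inverse to each other. *)
Lemma thin_shell_iso (I V V' : finType) (T : I -> {set V}) (T' : I -> {set V'}) d
    (ord ord' : I -> nat) :
  thin T d -> thin T' d -> (forall i j, adj T d i j = adj T' d i j) ->
  injective ord -> injective ord' -> shell T d ord -> shell T' d ord' ->
  (forall v, exists i, v \in T i) -> (forall v, exists i, v \in T' i) ->
  exists f : V -> V', bijective f /\ forall i, f @: T i = T' i.
Proof.
move=> tT tT' aE oi oi' sT sT' c c'.
have [f fP] := vertex_map tT tT' aE oi oi' sT sT' c.
have [g gP] := vertex_map tT' tT (fun i j => esym (aE i j)) oi' oi sT' sT c'.
have fK : cancel f g.
  move=> v; have [i vi] := c v; have [f1 f2] := fP i v vi; have [g1 g2] := gP i _ f1.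
  by apply: (nb_inj tT) g1 vi _; rewrite g2 f2.
have gK : cancel g f.
  move=> v; have [i vi] := c' v; have [f1 f2] := gP i v vi; have [g1 g2] := fP i _ f1.
  by apply: (nb_inj tT') g1 vi _; rewrite g2 f2.
exists f; split; first by exists g.
move=> i; apply/setP => w; apply/imsetP/idP => [[v /fP[h _] ->//]|wi].
by exists (g w); [have [] := gP i w wi | rewrite gK].
Qed.

(** * Brouwer's theorem for cubes *)

Section Cup.
Variables (P I : Type) (s : I -> P -> bool).

(** The simplicial coboundary modulo 2, on ordered lists of points: each entry is deleted in
    turn. *)
Fixpoint cobd (phi : seq P -> bool) (p : seq P) : bool :=
  if p is v :: q then phi q (+) cobd (fun r => phi (v :: r)) q else false.

(* The cup product modulo 2 of the coboundaries of the functions [s j], [j] in [J]. *)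
Fixpoint cup (J : seq I) (p : seq P) : bool :=
  if J is j :: J' then
    if p is v :: q then if q is w :: _ then (s j v (+) s j w) && cup J' q else false
    else false
  else size p == 1.

Definition cup1 j (J : seq I) (p : seq P) : bool :=
  if p is v :: _ then s j v && cup J p else false.

Lemma eq_cobd phi psi : phi =1 psi -> cobd phi =1 cobd psi.
Proof.
move=> e p; elim: p phi psi e => //= v q IHq phi psi e.
by rewrite e; congr (_ (+) _); apply: IHq => r; apply: e.
Qed.

Lemma cobdM b phi p : cobd (fun q => b && phi q) p = b && cobd phi p.
Proof. by elim: p phi => [|v q IHq] phi /=; rewrite ?andbF // IHq -andb_addr. Qed.

Lemma cobdD phi psi p : cobd (fun q => phi q (+) psi q) p = cobd phi p (+) cobd psi p.
Proof. by elim: p phi psi => [|v q IHq] phi psi //=; rewrite IHq addbACA. Qed.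

Lemma cup_nil J : cup J [::] = false.
Proof. by case: J. Qed.

(** Leibniz rule for the 0-cochain [s j] and the cocycle [cup J]. *)
Lemma cobd_cup1_aux j J : cobd (cup J) =1 xpred0 -> cobd (cup1 j J) =1 cup (j :: J).
Proof.
move=> cJ [|v q] //=; rewrite (cobdM (s j v) (fun r => cup J (v :: r))).
have -> : cobd (fun r : seq P => cup J (v :: r)) q = cup J q.
  by have /= := cJ (v :: q); case: (cup J q); case: cobd.
case: q => [|w r]; first by rewrite cup_nil andbF.
by rewrite /cup1 -andb_addl addbC.
Qed.

Lemma cobd_cup J : cobd (cup J) =1 xpred0.
Proof.
elim: J => [|j J IHJ] [|v q] //.
  case: q => [|w r] //=; rewrite eqSS.
  have -> : cobd (fun r0 : seq P => (size r0).+2 == 1) r = false.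
    by elim: r => //= x r'; rewrite (@eq_cobd _ (fun _ => false)) //.
  by rewrite addbF addbb.
(* With the first point [v] fixed, the factor for [j] splits into a term in the next point, whose
   coboundary is known, and a multiple of the cocycle [cup J]. *)
rewrite [cobd _ _]/= (@eq_cobd _ (fun r => cup1 j J r (+) (s j v && cup J r))); last first.
  by move=> [|w r] /=; rewrite ?cup_nil ?andbF // -andb_addl addbC.
by rewrite cobdD cobdM IHJ andbF addbF cobd_cup1_aux // addbb.
Qed.

Lemma cobd_cup1 j J : cobd (cup1 j J) =1 cup (j :: J).
Proof. exact/cobd_cup1_aux/cobd_cup. Qed.

End Cup.

(** * Lattice paths and sign changes in a grid *)

Section Grid.
Variables (n N : nat).
Local Notation pt := {ffun 'I_n -> nat}.
Implicit Types (x a v : pt) (J : {set 'I_n}) (L : seq 'I_n) (phi : seq pt -> bool) (p : seq pt).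

Definition shift x (j : 'I_n) t : pt := [ffun i => x i + t * (i == j)].

Lemma shiftE x j t i : shift x j t i = x i + t * (i == j).
Proof. by rewrite ffunE. Qed.

Lemma shiftC x j t l r : shift (shift x j t) l r = shift (shift x l r) j t.
Proof. by apply/ffunP => i; rewrite !ffunE addnAC. Qed.

Lemma shift_add x j t r : shift (shift x j t) j r = shift x j (t + r).
Proof. by apply/ffunP => i; rewrite !ffunE -addnA mulnDl. Qed.

Lemma shift0 x j : shift x j 0 = x.
Proof. by apply/ffunP => i; rewrite !ffunE addn0. Qed.

(* To be used with [m = #|J|]: sums [phi] over the monotone lattice paths from [x] to the opposite
   corner of the cube with directions [J]. *)
Fixpoint paths m J (phi : seq pt -> bool) x : bool :=
  if m is m'.+1 then
    \big[addb/false]_(j in J) paths m' (J :\ j) (fun p => phi (x :: p)) (shift x j 1)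
  else phi [:: x].

Lemma pathsS m J phi x : paths m.+1 J phi x =
  \big[addb/false]_(j in J) paths m (J :\ j) (fun p => phi (x :: p)) (shift x j 1).
Proof. by []. Qed.

Lemma eq_paths m J phi psi x : phi =1 psi -> paths m J phi x = paths m J psi x.
Proof.
elim: m J phi psi x => [|m IHm] J phi psi x e //=.
by apply: eq_bigr => j _; apply: IHm => p; apply: e.
Qed.

Lemma pathsD m J phi psi x :
  paths m J (fun p => phi p (+) psi p) x = paths m J phi x (+) paths m J psi x.
Proof.
elim: m J phi psi x => [|m IHm] J phi psi x //=.
by rewrite -big_split; apply: eq_bigr => j _; apply: IHm.
Qed.

Lemma paths_head m J phi psi b x : (forall p, phi (x :: p) = b && psi (x :: p)) ->
  paths m J phi x = b && paths m J psi x.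
Proof.
have pM m' J' chi y : paths m' J' (fun p => b && chi p) y = b && paths m' J' chi y.
  elim: m' J' chi y => [|m' IHm] J' chi y //=.
  by rewrite big_distrr /=; apply: eq_bigr => j _; apply: IHm.
move=> e; case: m => [|m] /=; first by rewrite e.
by rewrite big_distrr /=; apply: eq_bigr => j _; rewrite -pM; apply: eq_paths.
Qed.

(** Stokes' formula on a cube. Deleting an interior point of a path gives terms that cancel when the
    two steps at that point are exchanged; deleting an end leaves a path on a face of the cube. *)
Lemma paths_stokes m J phi x : #|J| = m.+1 ->
  paths m.+1 J (cobd phi) x =
  \big[addb/false]_(j in J) (paths m (J :\ j) phi (shift x j 1) (+) paths m (J :\ j) phi x).
Proof.
elim: m J phi x => [|m IHm] J phi x Jm.
  by rewrite /=; apply: eq_bigr => j _; rewrite addbF.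
rewrite pathsS.
transitivity (\big[addb/false]_(j in J) (paths m.+1 (J :\ j) phi (shift x j 1)
   (+) paths m.+1 (J :\ j) (cobd (fun r => phi (x :: r))) (shift x j 1))).
  by apply: eq_bigr => j _; rewrite -pathsD; apply: eq_paths.
rewrite big_split [RHS]big_split; congr (_ (+) _).
have cJ j : j \in J -> #|J :\ j| = m.+1 by move=> jJ; move: Jm; rewrite (cardsD1 j) jJ => -[].
transitivity (\big[addb/false]_(j in J) \big[addb/false]_(l in J)
  ((l != j) && (paths m (J :\ j :\ l) (fun r => phi (x :: r)) (shift (shift x j 1) l 1)
             (+) paths m (J :\ j :\ l) (fun r => phi (x :: r)) (shift x j 1)))).
  apply: eq_bigr => j jJ; rewrite IHm ?cJ //.
  rewrite big_mkcond [RHS]big_mkcond; apply: eq_bigr => l _; rewrite in_setD1.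
  by case: (l != j); case: (l \in J).
under eq_bigr => j _ do under eq_bigr => l _ do rewrite andb_addr.
under eq_bigr => j _ do rewrite big_split.
rewrite big_split /= xsum_sym ?addFb.
- rewrite exchange_big; apply: eq_bigr => j jJ.
  rewrite big_mkcond [RHS]big_mkcond; apply: eq_bigr => l _; rewrite in_setD1 eq_sym.
  rewrite !setDDl setUC.
  by case: (l != j); case: (l \in J).
- by move=> j _; rewrite eqxx.
- by move=> j l _ _; rewrite [in RHS]shiftC eq_sym !setDDl setUC.
Qed.

Lemma paths_inv m J phi x (l : 'I_n) : l \notin J ->
  (forall p, (forall v, v \in p -> v l = x l) -> phi p = false) ->
  paths m J phi x = false.
Proof.
elim: m J phi x => [|m IHm] J phi x lJ h /=.
  by apply: h => v; rewrite inE => /eqP ->.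
apply: big1 => j jJ.
have xl : shift x j 1 l = x l.
  by rewrite shiftE (_ : l == j = false) ?addn0 //; apply: contraNF lJ => /eqP ->.
apply: IHm => [|p hp]; first by rewrite in_setD1 (negbTE lJ) andbF.
by apply: h => v; rewrite inE => /orP[/eqP ->//|/hp ->].
Qed.

Lemma paths_true m J phi x : paths m J phi x -> exists2 p, phi p &
  forall v, v \in p -> forall i, x i <= v i <= x i + (i \in J).
Proof.
elim: m J phi x => [|m IHm] J phi x /=.
  by move=> h; exists [:: x] => // v; rewrite inE => /eqP -> i; rewrite leqnn leq_addr.
have [j /andP[jJ hj] _|no] := pickP (fun j => (j \in J) &&
   paths m (J :\ j) (fun p => phi (x :: p)) (shift x j 1)); last first.
  by rewrite big1 // => j jJ; have := no j; rewrite jJ.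
have [p pp hp] := IHm _ _ _ hj; exists (x :: p) => // v.
rewrite inE => /orP[/eqP -> i|/hp h i]; first by rewrite leqnn leq_addr.
have := h i; rewrite shiftE mul1n in_setD1 => /andP[h1 h2].
rewrite (leq_trans _ h1) ?leq_addr //= (leq_trans h2) // -addnA leq_add2l.
by have [->|] := eqVneq i j; rewrite ?jJ.
Qed.

Fixpoint gsum L (h : pt -> bool) a : bool :=
  if L is j :: L' then \big[addb/false]_(t < N) gsum L' h (shift a j t) else h a.

Lemma eq_gsum L h h' a (Q : pt -> Prop) : Q a ->
  (forall x j t, j \in L -> Q x -> Q (shift x j t)) ->
  (forall x, Q x -> h x = h' x) -> gsum L h a = gsum L h' a.
Proof.
elim: L a => [|j L IHL] a Qa QS e /=; first exact: e.
apply: eq_bigr => t _; apply: IHL => //; first by apply: QS; rewrite ?mem_head.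
by move=> x l r lL; apply: QS; rewrite in_cons lL orbT.
Qed.

Lemma gsum_sum L (K : finType) (A : {set K}) (h : K -> pt -> bool) a :
  gsum L (fun x => \big[addb/false]_(k in A) h k x) a = \big[addb/false]_(k in A) gsum L (h k) a.
Proof.
elim: L a => [|j L IHL] a //=.
by rewrite exchange_big; apply: eq_bigr => t _; rewrite IHL.
Qed.

Lemma gsumD L h h' a : gsum L (fun x => h x (+) h' x) a = gsum L h a (+) gsum L h' a.
Proof.
elim: L a => [|j L IHL] a //=.
by rewrite -big_split; apply: eq_bigr => t _; apply: IHL.
Qed.

Lemma gsum_shift L h j t a : gsum L (fun x => h (shift x j t)) a = gsum L h (shift a j t).
Proof.
elim: L a => [|l L IHL] a //=.
by apply: eq_bigr => r _; rewrite IHL shiftC.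
Qed.

Lemma gsum_front L1 j L2 h a : gsum (L1 ++ j :: L2) h a = gsum (j :: L1 ++ L2) h a.
Proof.
elim: L1 a => [|l L IHL] a //=.
under eq_bigr => t _ do rewrite IHL.
by rewrite exchange_big; apply: eq_bigr => t _; apply: eq_bigr => r _; rewrite shiftC.
Qed.

Lemma gsum_telescope L j h a :
  gsum (j :: L) (fun x => h (shift x j 1) (+) h x) a = gsum L h (shift a j N) (+) gsum L h a.
Proof.
rewrite /=; under eq_bigr => t _ do rewrite gsumD gsum_shift shift_add addn1.
elim: N => [|M IHM]; first by rewrite big_ord0 shift0 addbb.
by rewrite big_ord_recr /= IHM; case: gsum; case: gsum; case: gsum.
Qed.

Lemma gsum_true L h a : gsum L h a -> exists2 x, h x &
  forall i, (i \notin L -> x i = a i) /\ (a i = 0 -> uniq L -> i \in L -> x i < N).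
Proof.
elim: L a => [|j L IHL] a /=; first by move=> ha; exists a.
have [t ht _|no] := pickP (fun t : 'I_N => gsum L h (shift a j t)); last first.
  by rewrite big1 // => t _; rewrite no.
have [x hx xP] := IHL _ ht; exists x => // i; have [h1 h2] := xP i; split.
  rewrite inE negb_or => /andP[ij iL]; rewrite h1 // shiftE (negbTE ij) muln0 addn0 //.
move=> ai /andP[jL uL]; rewrite inE => /orP[/eqP ij|iL].
  by subst i; rewrite h1 // shiftE ai eqxx muln1 ltn_ord.
apply: h2 => //; rewrite shiftE ai (_ : i == j = false) ?muln0 //.
by apply: contraNF jL => /eqP <-.
Qed.

Variable s : 'I_n -> pt -> bool.
Hypotheses (s0 : forall j x, x j = 0 -> s j x = false) (sN : forall j x, x j = N -> s j x = true).

Lemma cup_const L l b p : l \in L -> (forall v, v \in p -> s l v = b) -> cup s L p = false.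
Proof.
elim: L p => [|j L IHL] // [|v [|w q]] //=; rewrite inE => lL h.
have [e|lj] := eqVneq l j; first by subst j; rewrite !h ?inE ?eqxx ?orbT // addbb.
rewrite IHL ?andbF //; first by rewrite (negbTE lj) in lL.
by move=> u uq; apply: h; rewrite inE uq orbT.
Qed.

(* Stokes: [cup (j :: L)] is the coboundary of [cup1 j L], which vanishes on all faces of the grid
   except [x j = N], where it is [cup L]. *)
Lemma total_cup L a : uniq L -> (forall j, j \in L -> a j = 0) ->
  gsum L (paths (size L) [set j in L] (cup s L)) a.
Proof.
elim: L a => [|j L IHL] a //= /andP[jL uL] a0.
rewrite -/(gsum (j :: L) _ a); set J := [set i in j :: L].
have cJ : #|J| = (size L).+1 by rewrite cardsE (card_uniqP _) //= jL.
have Jj : J :\ j = [set i in L].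
  apply/setP => i; rewrite !inE; case: eqVneq => [->|] //=.
  by rewrite (negbTE jL).
pose h l x := paths (size L) (J :\ l) (cup1 s j L) (shift x l 1)
  (+) paths (size L) (J :\ l) (cup1 s j L) x.
have -> : gsum (j :: L) (paths (size L).+1 J (cup s (j :: L))) a =
          gsum (j :: L) (fun x => \big[addb/false]_(l in J) h l x) a.
  apply: (@eq_gsum _ _ _ _ xpredT) => // x _.
  by rewrite -paths_stokes //; apply: eq_paths => p; rewrite cobd_cup1.
have jJ : j \in J by rewrite inE mem_head.
have -> : gsum (j :: L) (fun x => \big[addb/false]_(l in J) h l x) a =
   gsum (j :: L) (h j) a (+) \big[addb/false]_(l in J :\ j) gsum (j :: L) (h l) a.
  by rewrite gsum_sum (big_setD1 _ jJ).
rewrite big1 ?addbF => [|l].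
  rewrite /h Jj gsum_telescope.
  rewrite (@eq_gsum _ _ (fun=> false) a (fun x => x j = 0)); first last.
  - move=> x xj; rewrite (@paths_head _ _ _ (cup s L) false) // => p.
    by rewrite /= s0.
  - move=> x l t lL xj; rewrite shiftE xj (_ : j == l = false) ?muln0 //.
    by apply: contraNF jL => /eqP ->.
  - by rewrite a0 ?mem_head.
  rewrite (_ : gsum L (fun=> false) a = false) ?addbF; last first.
    by elim: (L) (a) => // l L' IH b /=; rewrite big1.
  rewrite (@eq_gsum _ _ (paths (size L) [set i in L] (cup s L)) _ (fun x => x j = N)).
  - apply: IHL => // i iL; rewrite shiftE a0 ?inE ?iL ?orbT // (_ : i == j = false) ?muln0 //.
    by apply: contraNF jL => /eqP <-.
  - by rewrite shiftE a0 ?mem_head // eqxx muln1.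
  - move=> x l t lL xj; rewrite shiftE xj (_ : j == l = false) ?muln0 ?addn0 //.
    by apply: contraNF jL => /eqP ->.
  - by move=> x xj; rewrite (@paths_head _ _ _ (cup s L) true) // => p /=; rewrite sN.
rewrite Jj inE => lL; rewrite -/(gsum (j :: L) _ a).
have lj : (l == j) = false by apply: contraNF jL => /eqP <-.
have van (b : pt) : b l = 0 \/ b l = N -> paths (size L) (J :\ l) (cup1 s j L) b = false.
  move=> bl; apply: (@paths_inv _ _ _ _ l); first by rewrite !inE eqxx.
  case=> [|v p] // hp; rewrite /= (@cup_const _ l (s l b)) ?andbF // => u /hp ul.
  by case: bl => bl; [rewrite !s0 // ul | rewrite !sN // ul].
have vanG (M : seq 'I_n) (b : pt) : l \notin M -> b l = 0 \/ b l = N ->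
    gsum M (paths (size L) (J :\ l) (cup1 s j L)) b = false.
  move=> lM bl; rewrite (@eq_gsum _ _ (fun=> false) _ (fun x => x l = 0 \/ x l = N)) //.
    by elim: (M) (b) => // k L' IH c /=; rewrite big1.
  move=> x i t iM; rewrite shiftE (_ : l == i = false) ?muln0 ?addn0 //.
  by apply: contraNF lM => /eqP ->.
have al : a l = 0 by rewrite a0 // inE lL orbT.
have : uniq (j :: L) by rewrite /= jL.
have : l \in j :: L by rewrite inE lL orbT.
rewrite /h; move: (j :: L) => M; case/splitPr => L1 L2.
rewrite uniq_catC /= mem_cat => /andP[lM _].
have lM' : l \notin L1 ++ L2 by rewrite mem_cat orbC.
rewrite gsum_front gsum_telescope (vanG _ _ lM'); last by right; rewrite shiftE al eqxx muln1.
by rewrite vanG //; left.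
Qed.

(** The cup product of all the coboundaries has odd sum over the grid, so it is 1 on some lattice
    path inside a unit cube. Each [s j] then changes value along a step of that path. *)
Lemma sign_cell : exists x, (forall i, x i < N) /\
  forall j, exists u v, [/\ s j u = false, s j v = true,
    forall i, x i <= u i <= (x i).+1 & forall i, x i <= v i <= (x i).+1].
Proof.
have := @total_cup (enum 'I_n) [ffun=> 0] (enum_uniq _) (fun j _ => ffunE _ _).
move=> /gsum_true[x /paths_true[p cp pP] xP]; exists x; split=> [i|j].
  by have [_] := xP i; apply; rewrite ?ffunE ?enum_uniq ?mem_enum.
have pP' v : v \in p -> forall i, x i <= v i <= (x i).+1.
  move=> vp i; have /andP[-> /=] := pP v vp i.
  by move/leq_trans; apply; rewrite -addn1 leq_add2l leq_b1.
have [u [v [up vp uv]]] : exists u v, [/\ u \in p, v \in p & s j u != s j v].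
  have jL : j \in enum 'I_n by rewrite mem_enum.
  elim: (enum 'I_n) p cp {pP pP'} jL => // l L IHL [|w [|w' p]] //= /andP[sw cL].
  rewrite inE => /orP[/eqP ->|/(IHL _ cL)[u [v [up vp uv]]]].
    exists w, w'; rewrite !inE !eqxx !orbT; split=> //.
    by move: sw; case: (s l w); case: (s l w').
  by exists u, v; rewrite inE up orbT inE vp orbT.
case su: (s j u) uv => uv; last by exists u, v; split; rewrite // -?(negbTE uv); case: (s j v) uv; auto.
by exists v, u; split; auto; case: (s j v) uv.
Qed.


End Grid.

From mathcomp Require Import all_classical all_reals all_analysis.
From mathcomp Require Import Rstruct Rstruct_topology lra ring.

Section Topology.
Import numFieldNormedType.Exports Order.TTheory GRing.Theory Num.Theory.
Local Open Scope ring_scope.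
Local Open Scope classical_set_scope.

(** * From grids to continuous maps of a cube *)

Section Brouwer.
Variable R : realType.

Lemma rV_normP n (x : 'rV[R]_n) (e : R) : 0 <= e ->
  reflect (forall i, `|x ord0 i| <= e) (`|x| <= e).
Proof.
move=> e0; rewrite [`|x|]mx_normrE; apply: (iffP idP) => [/bigmax_leP[_ h] i|h].
  exact: (h (ord0, i)).
by apply/bigmax_leP; split=> // -[i j] _ /=; rewrite (ord1 i).
Qed.

Lemma rV_coord_le n (x : 'rV[R]_n) i : `|x ord0 i| <= `|x|.
Proof. by apply/(rV_normP _ (normr_ge0 x)). Qed.

Lemma cvg_row (T : Type) (F : set_system T) (FF : Filter F) n (f : T -> 'rV[R]_n) (l : 'rV[R]_n) :
  (forall j, f x ord0 j @[x --> F] --> l ord0 j) -> f @ F --> l.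
Proof.
move=> h; apply/cvgrPdist_le => e e0.
have H j : \forall x \near F, `|l ord0 j - f x ord0 j| <= e.
  by move/cvgrPdist_le: (h j) => /(_ e e0).
have := filter_forall FF H.
apply: filterS => x hx; apply/(rV_normP _ (ltW e0)) => i.
by rewrite !mxE; apply: hx.
Qed.

Lemma grid_cell n (c : 'rV[R]_n) (r : R) (F : 'rV[R]_n -> 'rV[R]_n) (N : nat) :
  0 < r -> (forall p, `|p - c| = r -> F p = p) ->
  exists y, `|y - c| <= r /\ forall j, exists u v,
    [/\ `|u - c| <= r /\ `|v - c| <= r, F u ord0 j <= c ord0 j <= F v ord0 j,
       `|u - y| <= 2 * r * N.+1%:R^-1 & `|v - y| <= 2 * r * N.+1%:R^-1].
Proof.
move=> r0 Fb; set h := 2 * r * N.+1%:R^-1.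
have h0 : 0 <= h by rewrite !mulr_ge0 ?invr_ge0 // ltW.
have hN : h * N.+1%:R = 2 * r by rewrite mulfVK ?pnatr_eq0.
pose pos (x : {ffun 'I_n -> nat}) : 'rV[R]_n := \row_i (c ord0 i - r + h * (x i)%:R).
(* The sign of the [j]-th coordinate of [F - c], with the values that [sign_cell] requires imposed
   on the two extreme faces. They agree with [F] there because [F] fixes the boundary. *)
pose s j (x : {ffun 'I_n -> nat}) :=
  if x j == 0%N then false else if x j == N.+1 then true else c ord0 j <= F (pos x) ord0 j.
have [||x [xN xP]] := @sign_cell n N.+1 s.
- by move=> j x xj; rewrite /s xj.
- by move=> j x xj; rewrite /s xj eqxx.
have posc (u : {ffun 'I_n -> nat}) : (forall i, (u i <= N.+1)%N) -> `|pos u - c| <= r.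
  move=> ule; apply/(rV_normP _ (ltW r0)) => i; rewrite !mxE ler_norml.
  have : h * (u i)%:R <= 2 * r by rewrite -hN ler_wpM2l // ler_nat.
  have : 0 <= h * (u i)%:R by rewrite mulr_ge0.
  by move=> ? ?; apply/andP; split; lra.
have posd (u : {ffun 'I_n -> nat}) : (forall i, (x i <= u i <= (x i).+1)%N) -> `|pos u - pos x| <= h.
  move=> ux; apply/(rV_normP _ h0) => i; rewrite !mxE.
  have /andP[u1 u2] := ux i.
  have -> : c ord0 i - r + h * (u i)%:R - (c ord0 i - r + h * (x i)%:R) = h * (u i - x i)%:R.
    by rewrite natrB //; ring.
  rewrite ger0_norm; last by rewrite mulr_ge0.
  by apply: ler_piMr => //; rewrite (ler_nat R _ 1) leq_subLR addn1.
have ule (u : {ffun 'I_n -> nat}) : (forall i, (x i <= u i <= (x i).+1)%N) -> forall i, (u i <= N.+1)%N.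
  by move=> ux i; have /andP[_ h2] := ux i; apply: leq_trans h2 _; apply: xN.
have bd (u : {ffun 'I_n -> nat}) j : (forall i, (u i <= N.+1)%N) ->
    `|pos u ord0 j - c ord0 j| = r -> F (pos u) = pos u.
  move=> /posc uc uj; apply: Fb; apply/eqP; rewrite eq_le uc /= -[leLHS]uj.
  by have := rV_coord_le (pos u - c) j; rewrite !mxE.
exists (pos x); split; first by apply: posc => i; apply: ltnW.
move=> j; have [u [v [su sv ux vx]]] := xP j; exists (pos u), (pos v).
split; rewrite ?posd //; first by split; apply: posc; apply: ule.
apply/andP; split.
- move: su; rewrite /s; case: eqP => [uj _|_].
    have e : pos u ord0 j = c ord0 j - r by rewrite /pos mxE uj mulr0 addr0.
    rewrite (bd u j (ule u ux)) e; first by rewrite lerBlDr lerDl ltW.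
    by rewrite addrC addKr normrN gtr0_norm.
  by case: eqP => // _ /negbT; rewrite -ltNge => /ltW.
- move: sv; rewrite /s; case: eqP => // _; case: eqP => [vj _|//].
  have e : pos v ord0 j = c ord0 j + r by rewrite /pos mxE vj hN; ring.
  rewrite (bd v j (ule v vx)) e; first by rewrite lerDl ltW.
  by rewrite addrC addKr gtr0_norm.
Qed.

(** A form of the no-retraction theorem. By compactness the cells of [grid_cell], of mesh tending to
    0, accumulate at some [z], and continuity there squeezes each coordinate of [F z] onto that of
    [c]. *)
Lemma brouwer_cube n (c : 'rV[R]_n) (r : R) (F : 'rV[R]_n -> 'rV[R]_n) : 0 < r ->
  (forall p, `|p - c| <= r -> F @ within [set q | `|q - c| <= r] (nbhs p) --> F p) ->
  (forall p, `|p - c| = r -> F p = p) ->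
  exists p, `|p - c| <= r /\ F p = c.
Proof.
move=> r0 Fc Fb.
have /choice[y yP] := fun N => @grid_cell n c r F N r0 Fb.
have cK : compact [set q : 'rV[R]_n | `|q - c| <= r].
  have := @rV_compact _ n (fun i => `[c ord0 i - r, c ord0 i + r]%classic)
    (fun i => @segment_compact R (c ord0 i - r) (c ord0 i + r)).
  congr compact; apply/seteqP; split=> q /= hq.
    apply/(rV_normP _ (ltW r0)) => i; have := hq i; rewrite /= in_itv /= !mxE.
    by rewrite ler_distl.
  by move=> i; move/(rV_normP _ (ltW r0)): hq => /(_ i); rewrite !mxE in_itv /= ler_distl.
have [|z [zc zcl]] := cK (y @ \oo) _.
  by exists 0%N => // N _ /=; have [] := yP N.
exists z; split=> //; apply/rowP => j; apply/eqP/negPn/negP => ne.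
(* If the coordinates differ by [e], then near [z] that of [F] stays on one side of that of [c],
   whereas [u] and [v] realise both sides. *)
pose e := `|F z ord0 j - c ord0 j|.
have e0 : 0 < e by rewrite normr_gt0 subr_eq0.
have /cvgrPdist_lt/(_ e e0) := Fc z zc; rewrite near_withinE => /nbhs_ballP[d /= d0 dP].
have near0 : \forall N \near \oo, 2 * r * N.+1%:R^-1 < d / 2.
  have dr : 0 < d / 2 / (2 * r) by rewrite !divr_gt0 ?mulr_gt0.
  have := near_infty_natSinv_lt (PosNum dr); apply: filterS => N /=.
  by rewrite ltr_pdivlMr ?mulr_gt0 // mulrC.
have [N hN hzN] : exists2 N, 2 * r * N.+1%:R^-1 < d / 2 & `|z - y N| < d / 2.
  have [|q [[N /= hN <-] zq]] := zcl (y @` [set N | 2 * r * N.+1%:R^-1 < d / 2]) (ball z (d / 2)) _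
     (nbhsx_ballx z (d / 2) (divr_gt0 d0 (@ltr0n R 2))).
    by apply: filterS near0 => N hN /=; exists N.
  by exists N => //; rewrite -ball_normE in zq.
have [_ /(_ j)[u [v [[uc vc] /andP[Fu Fv] uy vy]]]] := yP N.
have close w : `|w - c| <= r -> `|w - y N| <= 2 * r * N.+1%:R^-1 -> `|F z ord0 j - F w ord0 j| < e.
  move=> wc wy; have := rV_coord_le (F z - F w) j; rewrite !mxE => /le_lt_trans; apply.
  apply: dP => //; rewrite -ball_normE /=.
  rewrite -(subrKA (y N)) (le_lt_trans (ler_normD _ _)) // [ltRHS](splitr d) ltrD //.
  by rewrite distrC (le_lt_trans wy).
have := close u uc uy; have := close v vc vy; rewrite /e !ltr_norml.
have [zl|zg] := leP (F z ord0 j) (c ord0 j).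
  by rewrite ler0_norm ?subr_le0 // => /andP[h1 h2] _; lra.
by rewrite gtr0_norm ?subr_gt0 // => _ /andP[h1 h2]; lra.
Qed.

End Brouwer.

(** * Ridges of a simplicial sphere *)

Lemma cvg_to_within (T : Type) (U : topologicalType) (F : set_system T) (FF : Filter F)
  (h : T -> U) (A : set U) (z : U) :
  h @ F --> z -> (\forall x \near F, A (h x)) -> h @ F --> within A (nbhs z).
Proof.
move=> hz hA P; rewrite /within /= => zP.
have := hz _ zP; rewrite /= => H.
by apply: filterS2 hA H => x Ax; apply.
Qed.

Lemma near_within_self (U : topologicalType) (A : set U) (p : U) (P : set U) :
  A `<=` P -> \forall x \near within A (nbhs p), P x.
Proof. by move=> AP; rewrite near_withinE; apply: nearW. Qed.

Lemma cvg_sumr (R : numFieldType) (W : normedModType R) (T : Type)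
  (F : set_system T) (FF : Filter F) (I : Type) (r : seq I) (P : pred I)
  (h : I -> T -> W) (l : I -> W) : (forall i, P i -> h i @ F --> l i) ->
  (fun x => \sum_(i <- r | P i) h i x) @ F --> \sum_(i <- r | P i) l i.
Proof.
move=> hl; elim: r => [|i r IHr].
  by rewrite big_nil; under eq_cvg do rewrite big_nil; exact: cvg_cst.
rewrite big_cons; under eq_cvg do rewrite big_cons.
by case: ifPn => // Pi; apply: cvgD => //; apply: hl.
Qed.

(** * The Euclidean norm *)

Section Euclid.
Variables (R : realType) (n : nat).
Implicit Types y w : 'rV[R]_n.

(** Needed beside the norm of row vectors, which is the maximum norm. *)
Definition nrm y : R := Num.sqrt (\sum_i y ord0 i ^+ 2).

Lemma nrm_ge0 y : 0 <= nrm y.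
Proof. exact: sqrtr_ge0. Qed.

Lemma sumsq_ge0 y : 0 <= \sum_i y ord0 i ^+ 2.
Proof. by apply: sumr_ge0 => i _; apply: sqr_ge0. Qed.

Lemma nrmZ a y : nrm (a *: y) = `|a| * nrm y.
Proof.
rewrite /nrm (eq_bigr (fun i => a ^+ 2 * y ord0 i ^+ 2)); last by move=> i _; rewrite mxE exprMn.
by rewrite -mulr_sumr sqrtrM ?sqr_ge0 // sqrtr_sqr.
Qed.

Lemma nrm_eq0 y : (nrm y == 0) = (y == 0).
Proof.
apply/idP/eqP => [|->]; last first.
  by rewrite /nrm big1 ?sqrtr0 // => i _; rewrite mxE expr0n.
rewrite sqrtr_eq0 => h; apply/rowP => i; rewrite mxE.
have /eqP : \sum_i y ord0 i ^+ 2 == 0 by rewrite eq_le h sumsq_ge0.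
move/psumr_eq0P => /(_ (fun i _ => sqr_ge0 _)) /(_ i isT) /eqP.
by rewrite sqrf_eq0 => /eqP.
Qed.

Lemma nrm_gt0 y : (0 < nrm y) = (y != 0).
Proof. by rewrite lt_neqAle eq_sym nrm_eq0 nrm_ge0 andbT. Qed.

Lemma nrm1 y : nrm y = 1 <-> \sum_i y ord0 i ^+ 2 = 1.
Proof.
split=> [h|h]; last by rewrite /nrm h sqrtr1.
by rewrite -[LHS](sqr_sqrtr (sumsq_ge0 y)) -/(nrm y) h expr1n.
Qed.

Lemma nrm_cvg y : nrm @ nbhs y --> nrm y.
Proof.
apply: (@cvg_comp _ _ _ (fun y => \sum_i y ord0 i ^+ 2) Num.sqrt _
  (nbhs (\sum_i y ord0 i ^+ 2))); last exact: sqrt_continuous.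
apply: cvg_sumr => i _; under eq_cvg do rewrite expr2.
by rewrite expr2; apply: cvgM; apply: coord_continuous.
Qed.

End Euclid.

(** * The cone over the realization *)

Section Cone.
Variables (R : realType) (V : finType) (D : {set {set V}}) (k : nat).
Local Notation X := 'rV[R]_#|V|.
Local Notation Y := 'rV[R]_k.+1.
Implicit Types (x z : X) (y w : Y).

Definition coord x (v : V) : R := x ord0 (enum_rank v).

Definition face_of x : {set V} := [set v | coord x v != 0]%SET.

Definition realization : set X :=
  [set x | [/\ (forall v, 0 <= coord x v), \sum_(v : V) coord x v = 1 & face_of x \in D]].

Definition sphere : set Y := [set y | \sum_(i < k.+1) (y ord0 i) ^+ 2 = 1].

Definition vec (h : V -> R) : X := \row_i h (enum_val i).

Lemma vecE h v : coord (vec h) v = h v.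
Proof. by rewrite /coord mxE enum_rankK. Qed.

Lemma coordP x z : (forall v, coord x v = coord z v) -> x = z.
Proof.
move=> h; apply/rowP => i; have := h (enum_val i).
by rewrite /coord enum_valK.
Qed.

Lemma coordD x z v : coord (x + z) v = coord x v + coord z v.
Proof. by rewrite /coord mxE. Qed.

Lemma coordZ a x v : coord (a *: x) v = a * coord x v.
Proof. by rewrite /coord mxE. Qed.

Lemma in_face_of x v : (v \in face_of x) = (coord x v != 0).
Proof. by rewrite inE. Qed.

Lemma cvg_coord x v : (fun z => coord z v) @ nbhs x --> coord x v.
Proof. exact: coord_continuous. Qed.

Lemma coord_le x v : `|coord x v| <= `|x|.
Proof. exact: rV_coord_le. Qed.

Definition mass x : R := \sum_v coord x v.

Lemma massZ a x : mass (a *: x) = a * mass x.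
Proof. by rewrite /mass mulr_sumr; apply: eq_bigr => v _; rewrite coordZ. Qed.

Lemma face_ofZ a x : a != 0 -> face_of (a *: x) = face_of x.
Proof. by move=> a0; apply/setP => v; rewrite !in_face_of coordZ mulf_eq0 negb_or a0. Qed.

Definition cone : set X := [set z | [/\ forall v, 0 <= coord z v, face_of z \in D & 0 < mass z]].

Lemma cone_geom z : cone z -> realization ((mass z)^-1 *: z).
Proof.
move=> [z0 zD zm]; split=> [v||].
- by rewrite coordZ mulr_ge0 // invr_ge0 ltW.
- by rewrite -/(mass _) massZ mulVf // gt_eqF.
- by rewrite face_ofZ // invr_eq0 gt_eqF.
Qed.

Lemma geom_cone a z : 0 < a -> realization z -> cone (a *: z) /\ mass (a *: z) = a.
Proof.
move=> a0 [z0 z1 zD]; have m : mass (a *: z) = a by rewrite massZ /mass z1 mulr1.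
split=> //; split=> [v||]; rewrite ?m //.
- by rewrite coordZ mulr_ge0 // ltW.
- by rewrite face_ofZ // gt_eqF.
Qed.

Variables (f : X -> Y) (g : Y -> X).
Hypotheses (fS : f @` realization `<=` sphere) (gD : g @` sphere `<=` realization).
Hypotheses (fK : forall x, realization x -> g (f x) = x) (gK : forall y, sphere y -> f (g y) = y).
Hypotheses (fc : {within realization, continuous f}) (gc : {within sphere, continuous g}).

(** The radial extensions of [f] and [g] identify the cone with Euclidean space minus the origin,
    where cubes around a point are available for [brouwer_cube]. *)
Definition cmap z : Y := mass z *: f ((mass z)^-1 *: z).
Definition cinv w : X := nrm w *: g ((nrm w)^-1 *: w).

Lemma sphereP y : sphere y <-> nrm y = 1.
Proof. by rewrite nrm1. Qed.

Lemma unit_sphere w : w != 0 -> sphere ((nrm w)^-1 *: w).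
Proof.
move=> w0; apply/sphereP; rewrite nrmZ ger0_norm ?invr_ge0 ?nrm_ge0 // mulVf //.
by rewrite nrm_eq0.
Qed.

Lemma nrm_cmap z : cone z -> nrm (cmap z) = mass z.
Proof.
move=> cz; have [_ _ m0] := cz; rewrite nrmZ gtr0_norm //.
have /sphereP -> : sphere (f ((mass z)^-1 *: z)).
  by apply: fS; exists ((mass z)^-1 *: z) => //; exact: cone_geom.
by rewrite mulr1.
Qed.

Lemma cmap_neq0 z : cone z -> cmap z != 0.
Proof. by move=> cz; rewrite -nrm_gt0 nrm_cmap //; case: cz. Qed.

Lemma cmapK z : cone z -> cinv (cmap z) = z.
Proof.
move=> cz; have [_ _ m0] := cz; have mn : mass z != 0 by rewrite gt_eqF.
rewrite /cinv nrm_cmap // /cmap scalerA mulVf // scale1r fK; last exact: cone_geom.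
by rewrite scalerA divff // scale1r.
Qed.

Lemma cinv_cone w : w != 0 -> cone (cinv w) /\ mass (cinv w) = nrm w.
Proof.
move=> w0; apply: geom_cone; first by rewrite nrm_gt0.
by apply: gD; exists ((nrm w)^-1 *: w) => //; exact: unit_sphere.
Qed.

Lemma cinvK w : w != 0 -> cmap (cinv w) = w.
Proof.
move=> w0; have [_ m] := cinv_cone w0; have n0 : nrm w != 0 by rewrite nrm_eq0.
rewrite /cmap m /cinv scalerA mulVf // scale1r gK; last exact: unit_sphere.
by rewrite scalerA divff // scale1r.
Qed.

Lemma cmap_inj z x : cone z -> cone x -> cmap z = cmap x -> z = x.
Proof. by move=> cz cx e; rewrite -(cmapK cz) e cmapK. Qed.

Lemma mass_cvg x : mass @ nbhs x --> mass x.
Proof. by apply: cvg_sumr => v _; apply: cvg_coord. Qed.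

Lemma cinv_cvg w : w != 0 -> cinv @ nbhs w --> cinv w.
Proof.
move=> w0; have n0 : nrm w != 0 by rewrite nrm_eq0.
apply: cvgZ; first exact: nrm_cvg.
apply: (@cvg_comp _ _ _ (fun y => (nrm y)^-1 *: y) g _
  (within sphere (nbhs ((nrm w)^-1 *: w)))); last first.
  by move/subspace_continuousP: gc; apply; exact: unit_sphere.
apply: cvg_to_within.
  by apply: cvgZ; [apply: cvgV => //; exact: nrm_cvg|exact: cvg_id].
have : \forall y \near w, 0 < nrm y.
  by apply: (cvgr_gt _ (nrm_cvg (y := w))); rewrite nrm_gt0.
by apply: filterS => y; rewrite nrm_gt0; exact: unit_sphere.
Qed.

Lemma cmap_cvg z : cone z -> cmap @ within cone (nbhs z) --> cmap z.
Proof.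
move=> cz; have [_ _ m0] := cz; have mn : mass z != 0 by rewrite gt_eqF.
apply: cvgZ; first by apply: cvg_within_filter; exact: mass_cvg.
apply: (@cvg_comp _ _ _ (fun z => (mass z)^-1 *: z) f _
  (within realization (nbhs ((mass z)^-1 *: z)))); last first.
  by move/subspace_continuousP: fc; apply; exact: cone_geom.
apply: cvg_to_within.
  apply: cvg_within_filter; apply: cvgZ; [apply: cvgV => //; exact: mass_cvg|exact: cvg_id].
by apply: near_within_self => x; exact: cone_geom.
Qed.

(** An unnormalised barycentre of [s]. *)
Definition ind (s : {set V}) : X := vec (fun v => (v \in s)%:R).

Lemma indE s v : coord (ind s) v = (v \in s)%:R.
Proof. exact: vecE. Qed.

Lemma face_of_ind s : face_of (ind s) = s.
Proof. by apply/setP => v; rewrite in_face_of indE pnatr_eq0 eqb0 negbK. Qed.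

Lemma cone_intro z v : (forall u, 0 <= coord z u) -> face_of z \in D -> 0 < coord z v -> cone z.
Proof.
move=> z0 zD zv; split=> //; apply: (lt_le_trans zv).
by rewrite /mass (bigD1 v) //= lerDl sumr_ge0.
Qed.

Lemma cone_ind s v : s \in D -> v \in s -> cone (ind s).
Proof.
move=> sD vs; apply: (@cone_intro _ v); rewrite ?face_of_ind ?indE ?vs //.
by move=> u; rewrite indE.
Qed.

Lemma cvg_vec (T : Type) (F : set_system T) (FF : Filter F) (h : T -> V -> R) (l : V -> R) :
  (forall v, h t v @[t --> F] --> l v) -> vec (h t) @[t --> F] --> vec l.
Proof.
move=> hl; apply: cvg_row => j; rewrite mxE; under eq_cvg do rewrite mxE.
exact: hl.
Qed.

Lemma coord_norm_le x e : 0 <= e -> (forall v, `|coord x v| <= e) -> `|x| <= e.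
Proof.
move=> e0 h; apply/(rV_normP _ e0) => i; have := h (enum_val i).
by rewrite /coord enum_valK.
Qed.

Lemma coordB x z v : coord (x - z) v = coord x v - coord z v.
Proof. by rewrite /coord !mxE. Qed.

Lemma cinv_cmap_cvg x : cone x -> cinv @ nbhs (cmap x) --> x.
Proof. by move=> cx; rewrite -{2}(cmapK cx); apply: cinv_cvg; apply: cmap_neq0. Qed.

Hypothesis downD : forall s t : {set V}, s \in D -> t \subset s -> t \in D.

(* If [a |: r] is the only facet at the ridge [r], pushing a neighbourhood of a point of the
   relative interior of [r] towards the interior of that facet moves it off the point. *)
Lemma ridge_not_one (r : {set V}) a : r != finset.set0 -> a \notin r -> a |: r \in D ->
  ~ (forall s, s \in D -> r \subset s -> s \subset a |: r).
Proof.
move=> /set0Pn[v0 v0r] ar arD uniqF.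
have rD : r \in D by apply: downD arD _; rewrite finset.subsetUr.
set x := ind r; set w := ind (a |: r); set x0 := cmap x.
have cx : cone x := cone_ind rD v0r.
have x00 : x0 != 0 by apply: cmap_neq0.
(* Near [x0] the preimages have positive coordinates on [r], so their supports contain [r] and lie
   in the facet [a |: r]. *)
have [rho rho0 near_x0] : exists2 rho, 0 < rho & forall y, `|y - x0| <= rho ->
    y != 0 /\ forall v, v \in r -> 0 < coord (cinv y) v.
  have H1 : \forall y \near x0, 0 < nrm y.
    by apply: (cvgr_gt _ (nrm_cvg (y := x0))); rewrite nrm_gt0.
  have H2 : \forall y \near x0, forall v, v \in r -> 0 < coord (cinv y) v.
    have H v : \forall y \near x0, v \in r -> 0 < coord (cinv y) v.
      case vr : (v \in r); last by apply: filterE.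
      have cv : coord (cinv y) v @[y --> x0] --> coord x v.
        apply: (@cvg_comp _ _ _ cinv (fun z => coord z v) _ (nbhs x)); last exact: cvg_coord.
        exact: cinv_cmap_cvg.
      have : \forall y \near x0, 0 < coord (cinv y) v.
        by apply: (cvgr_gt _ cv); rewrite indE vr.
      by apply: filterS.
    exact: (filter_forall _ H).
  have /nbhs_ballP[e /= e0 eP] : nbhs x0 [set y | 0 < nrm y /\ forall v, v \in r -> 0 < coord (cinv y) v].
    exact: filterI H1 H2.
  exists (e / 2); first by rewrite divr_gt0.
  move=> y ye; have [] : (0 < nrm y) /\ (forall v, v \in r -> 0 < coord (cinv y) v).
    apply: eP; rewrite -ball_normE /= distrC (le_lt_trans ye) //.
    by rewrite ltr_pdivrMr // ltr_pMr // ltr1n.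
  by rewrite nrm_gt0.
(* The weight [tau] is 1 at [x0] and 0 on the boundary of the cube, so [cmap \o G] is the identity
   on that boundary. *)
pose tau y := (rho - `|y - x0|) / rho.
pose G y := (1 - tau y) *: cinv y + tau y *: w.
have tau01 y : `|y - x0| <= rho -> 0 <= tau y <= 1.
  move=> yr; rewrite divr_ge0 ?subr_ge0 ?(ltW rho0) //= ler_pdivrMr // mul1r.
  by rewrite lerBlDr lerDl.
have GE y v : coord (G y) v = (1 - tau y) * coord (cinv y) v + tau y * (v \in a |: r)%:R.
  by rewrite coordD !coordZ indE.
have coneG y : `|y - x0| <= rho -> cone (G y).
  move=> yr; have [y0 yv] := near_x0 y yr; have [cy _] := cinv_cone y0.
  have /andP[t0 t1] := tau01 y yr; have [c0 cD _] := cy.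
  apply: (@cone_intro _ v0).
  - by move=> u; rewrite GE; apply: addr_ge0; apply: mulr_ge0; rewrite // subr_ge0.
  - apply: downD arD _; apply/fintype.subsetP => u; rewrite in_face_of GE; apply: contraNT => ua.
    rewrite (negbTE ua) mulr0 addr0 mulf_eq0; apply/orP; right.
    have : u \notin face_of (cinv y).
      apply: contra ua; apply/fintype.subsetP/uniqF => //.
      by apply/fintype.subsetP => v /yv; rewrite in_face_of => /gt_eqF ->.
    by rewrite in_face_of negbK.
  - rewrite GE !inE v0r orbT mulr1; have [t_gt0|t_le0] := ltP 0 (tau y).
      by apply: ltr_wpDl => //; apply: mulr_ge0; rewrite // subr_ge0.
    have -> : tau y = 0 by apply/eqP; rewrite eq_le t_le0.
    by rewrite subr0 mul1r addr0 yv.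
have [||p [pr Fp]] := @brouwer_cube R _ x0 rho (cmap \o G) rho0.
- move=> p pr; have [p0 _] := near_x0 p pr.
  apply: (@cvg_comp _ _ _ G cmap _ (within cone (nbhs (G p)))); last exact/cmap_cvg/coneG.
  apply: cvg_to_within; last by apply: near_within_self => y; exact: coneG.
  apply: cvg_within_filter.
  have tc : tau @ nbhs p --> tau p.
    apply: cvgM; last exact: cvg_cst.
    apply: cvgB; first exact: cvg_cst.
    apply: cvg_norm; apply: cvgB; [exact: cvg_id|exact: cvg_cst].
  apply: cvgD; apply: cvgZ => //; first by apply: cvgB => //; exact: cvg_cst.
    exact: cinv_cvg.
  exact: cvg_cst.
- move=> p pr; have [|p0 _] := near_x0 p; first by rewrite pr.
  rewrite /= /G.
  have -> : tau p = 0 by rewrite /tau pr subrr mul0r.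
  by rewrite subr0 scale1r scale0r addr0 cinvK.
have [p0 _] := near_x0 p pr; have [[c0 _ _] _] := cinv_cone p0.
have /andP[t0 t1] := tau01 p pr.
have Gx : G p = x by apply: cmap_inj => //; exact: coneG.
(* The coordinate at [a] is 0 in [x] and at least [tau p] in [G p], so [tau p] vanishes. Then [G p]
   is [cinv p] and [p] is [x0], where [tau] is 1. *)
have := GE p a; rewrite Gx indE (negbTE ar) setU11 mulr1 => /esym/eqP.
rewrite paddr_eq0 //; last by apply: mulr_ge0; rewrite // subr_ge0.
move=> /andP[_ /eqP tp].
move: Gx; rewrite /G tp subr0 scale1r scale0r addr0 => cp.
have px : p = x0 by rewrite /x0 -cp cinvK.
by move: tp; rewrite /tau px subrr normr0 subr0 divff ?gt_eqF // => /eqP; rewrite oner_eq0.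
Qed.

(* The facets [a |: r] and [b |: r] span a ball around a point [x] of the relative interior of [r].
   Pushing its image away from the image [y] of a point of [c |: r] close to [x], and then folding
   the complex onto that ball, moves the ball off [x]. *)
Lemma ridge_not_three (r : {set V}) a b c : r != finset.set0 ->
  a \notin r -> b \notin r -> c \notin r -> a != b -> a != c -> b != c ->
  a |: r \in D -> b |: r \in D -> c |: r \in D ->
  ~ (forall s, s \in D -> r \subset s -> exists v, s \subset v |: r).
Proof.
move=> /set0Pn[v0 v0r] ar br cr ab ac bc arD brD crD one_more.
have rD : r \in D by apply: downD arD _; rewrite finset.subsetUr.
set x := ind r; set x0 := cmap x.
have cx : cone x := cone_ind rD v0r.
have neqr u v : u \in r -> v \notin r -> (v == u) = false.
  by move=> ur vr; apply: contraNF vr => /eqP ->.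
pose Q := [set p : X | `|p - x| <= 1 / 2].
(* The coordinate at [a] is spread over the two facets: its positive part goes to [a], its negative
   part to [b]. The coordinates outside [a |: r] are dummies that let Brouwer's theorem be used in
   the whole space. *)
pose h (p : X) v : R := if v \in r then coord p v
  else if v == a then (`|coord p a| + coord p a) / 2
  else if v == b then (`|coord p a| - coord p a) / 2 else 0.
pose zt p := vec (h p).
have ztE p v : coord (zt p) v = h p v by rewrite /zt vecE.
have Qr p v : Q p -> v \in r -> 1 / 2 <= coord p v.
  move=> Qp vr; have := le_trans (coord_le (p - x) v) Qp.
  by rewrite coordB indE vr /= mulr1n ler_norml => /andP[h1 _]; lra.
have zt_ge0 p v : Q p -> 0 <= coord (zt p) v.
  move=> Qp; rewrite ztE /h; case: ifP => [/(Qr p v Qp)|_]; first lra.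
  have := ler_norm (coord p a); have := ler_norm (- coord p a); rewrite normrN => n1 n2.
  by case: ifP => _; last case: ifP => _ //; apply: divr_ge0 => //; lra.
have cone_zt p : Q p -> cone (zt p).
  move=> Qp; apply: (@cone_intro _ v0); first by move=> u; apply: zt_ge0.
  - have [pa|pa] := leP 0 (coord p a); [apply: downD arD _ | apply: downD brD _];
      apply/fintype.subsetP => u; rewrite in_face_of ztE /h !inE;
      case: (u \in r); rewrite ?orbT // orbF; case: (u == a) => //; case: (u == b); rewrite ?eqxx //.
    + by rewrite ger0_norm // subrr mul0r eqxx.
    + by rewrite ltr0_norm // addrC subrr mul0r eqxx.
  - by rewrite ztE /h v0r; have := Qr p v0 Qp v0r; lra.
pose xi p := cmap (zt p).
have nrm_xi p : Q p -> 1 / 2 <= nrm (xi p).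
  move=> Qp; rewrite nrm_cmap; last exact: cone_zt.
  rewrite /mass (bigD1 v0) //=; apply: (@le_trans _ _ (coord (zt p) v0)).
    by rewrite ztE /h v0r Qr.
  by rewrite lerDl sumr_ge0 // => u _; apply: zt_ge0.
(* A displacement shorter than [d1] cannot carry a point [xi p] to the origin. *)
have [d1 d10 d1P] : exists2 d1 : R, 0 < d1 & forall w : Y, `|w| < d1 -> nrm w < 1 / 2.
  have n0 : nrm (0 : Y) = 0 by apply/eqP; rewrite nrm_eq0.
  have : \forall w \near (0 : Y), nrm w < 1 / 2.
    by apply: (cvgr_lt _ (nrm_cvg (y := 0))); rewrite n0; lra.
  move=> /nbhs_ballP[e /= e0 eP]; exists e => // w we; apply: eP.
  by rewrite -ball_normE /= sub0r normrN.
have [d2 d20 d2P] : exists2 d2 : R, 0 < d2 & forall w, `|w - x0| < d2 -> `|cinv w - x| < 1 / 8.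
  have e8 : 0 < 1 / 8 :> R by lra.
  have /cvgrPdist_lt/(_ _ e8) := cinv_cmap_cvg cx.
  move=> /nbhs_ballP[e /= e0 eP]; exists e => // w we; rewrite distrC; apply: eP.
  by rewrite -ball_normE /= distrC.
(* A point of the third facet close to [x]; its coordinate at [c] keeps its image [y] out of the
   range of [xi]. *)
pose x' e := x + e *: ind [set c]%SET.
have x'E e v : coord (x' e) v = (v \in r)%:R + e * (v == c)%:R.
  by rewrite coordD coordZ !indE inE.
have cone_x' e : 0 < e -> cone (x' e).
  move=> e0; apply: (@cone_intro _ v0).
  - by move=> u; rewrite x'E addr_ge0 // mulr_ge0 // ltW.
  - apply: downD crD _; apply/fintype.subsetP => u; rewrite in_face_of x'E !inE.
    by case: (u == c) => //; case: (u \in r) => //; rewrite mulr0 addr0 eqxx.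
  - by rewrite x'E v0r eq_sym (neqr _ _ v0r cr) mulr0 addr0.
have [e e0 ey] : exists2 e : R, 0 < e & `|cmap (x' e) - x0| < Num.min d1 d2 / 2.
  have m0 : 0 < Num.min d1 d2 / 2 by rewrite divr_gt0 // lt_min d10.
  have /cvgrPdist_lt/(_ _ m0) := cmap_cvg cx; rewrite near_withinE.
  move=> /nbhs_ballP[e /= e0 eP]; exists (e / 2); first by rewrite divr_gt0.
  rewrite distrC; apply: eP; last by apply: cone_x'; rewrite divr_gt0.
  rewrite -ball_normE /= opprD addNKr normrN.
  apply: (@le_lt_trans _ _ (e / 2)); last by rewrite ltr_pdivrMr // ltr_pMr // ltr1n.
  apply: coord_norm_le => [|v]; first by rewrite divr_ge0 // ltW.
  rewrite coordZ indE normrM ger0_norm; last by rewrite divr_ge0 // ltW.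
  apply: ler_piMr; first by rewrite divr_ge0 // ltW.
  by case: (v \in _); rewrite ?normr1 ?normr0.
set y := cmap (x' e) in ey; set delta := `|y - x0|.
have delta0 : 0 < delta.
  rewrite normr_gt0 subr_eq0; apply/eqP => /(cmap_inj (cone_x' e e0) cx) /(congr1 (fun z => coord z c)).
  by rewrite x'E indE (negbTE cr) eqxx add0r mulr1 => e_eq; rewrite e_eq ltxx in e0.
have [dd1 dd2] : 2 * delta < d1 /\ 2 * delta < d2.
  have h1 : Num.min d1 d2 <= d1 by rewrite ge_min lexx.
  have h2 : Num.min d1 d2 <= d2 by rewrite ge_min lexx orbT.
  by move: ey; rewrite -/delta => ey; split; lra.
have xi_y p : Q p -> xi p - y != 0.
  move=> Qp; rewrite subr_eq0; apply/eqP => /(cmap_inj (cone_zt p Qp) (cone_x' e e0)).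
  move=> /(congr1 (fun z => coord z c)).
  rewrite ztE x'E /h (negbTE cr) eqxx add0r mulr1.
  rewrite [c == a]eq_sym (negbTE ac) [c == b]eq_sym (negbTE bc) => e_eq.
  by rewrite -e_eq ltxx in e0.
(* The push away from [y] has length [2 * delta] at the centre of the cube, twice the distance from
   [y] to [x0], and vanishes on the boundary. *)
pose tau p := 1 - 2 * `|p - x|.
have tau01 p : Q p -> 0 <= tau p <= 1.
  by rewrite /Q /tau /= => Qp; have := normr_ge0 (p - x) => ?; apply/andP; split; lra.
pose W p := xi p + (tau p * (2 * delta) * `|xi p - y|^-1) *: (xi p - y).
have W0 p : Q p -> W p != 0.
  move=> Qp; apply/eqP => /(congr1 (fun w => w - xi p)); rewrite sub0r /W addrAC subrr add0r.
  move=> /(congr1 Num.norm); rewrite normrZ normrN normrM normfV normr_id.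
  rewrite -mulrA mulVf ?mulr1 ?normr_eq0 ?xi_y //.
  have /andP[t0 t1] := tau01 p Qp; rewrite ger0_norm; last by rewrite mulr_ge0 // mulr_ge0 // ltW.
  move=> xin; have := nrm_xi p Qp; rewrite leNgt => /negP; apply; apply: d1P; rewrite -xin.
  by apply: le_lt_trans dd1; apply: ler_piMl => //; rewrite mulr_ge0 // ltW.
pose zeta p := cinv (W p).
(* The folding: outside [r], the coordinate at [b] is subtracted and all the others are added to
   give the coordinate at [a]. On the boundary this undoes [zt]. *)
pose hF p v := if v \in r then coord (zeta p) v
  else if v == a then \sum_(u | (u \notin r) && (u != b)) coord (zeta p) u - coord (zeta p) b
  else coord p v.
pose F p := vec (hF p).
have FE p v : coord (F p) v = hF p v by rewrite /F vecE.
have [|||p [Qp Fp]] := @brouwer_cube R _ x (1 / 2) F.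
- by lra.
- move=> p Qp; rewrite -/Q.
  have ztc : zt @ nbhs p --> zt p.
    apply: cvg_vec => v; rewrite /h; case: ifP => _; first exact: cvg_coord.
    have na : `|coord q a| @[q --> nbhs p] --> `|coord p a|.
      by apply: cvg_norm; exact: cvg_coord.
    case: ifP => _; last case: ifP => _; last exact: cvg_cst.
      by apply: cvgM; [apply: cvgD => //; exact: cvg_coord|exact: cvg_cst].
    by apply: cvgM; [apply: cvgB => //; exact: cvg_coord|exact: cvg_cst].
  have xic : xi @ within Q (nbhs p) --> xi p.
    apply: (@cvg_comp _ _ _ zt cmap _ (within cone (nbhs (zt p)))); last exact/cmap_cvg/cone_zt.
    apply: cvg_to_within; first by apply: cvg_within_filter.
    by apply: near_within_self => q; exact: cone_zt.
  have tauc : tau @ within Q (nbhs p) --> tau p.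
    apply: cvg_within_filter; apply: cvgB; first exact: cvg_cst.
    apply: cvgM; first exact: cvg_cst.
    by apply: cvg_norm; apply: cvgB; [exact: cvg_id|exact: cvg_cst].
  have xyc : xi q - y @[q --> within Q (nbhs p)] --> xi p - y.
    by apply: cvgB => //; exact: cvg_cst.
  have Wc : W @ within Q (nbhs p) --> W p.
    apply: cvgD => //; apply: cvgZ => //; apply: cvgM.
      by apply: cvgM => //; exact: cvg_cst.
    by apply: cvgV; [rewrite normr_eq0 xi_y|apply: cvg_norm].
  have zc v : coord (zeta q) v @[q --> within Q (nbhs p)] --> coord (zeta p) v.
    apply: (@cvg_comp _ _ _ zeta (fun z => coord z v) _ (nbhs (zeta p))); last exact: cvg_coord.
    by apply: (@cvg_comp _ _ _ W cinv _ (nbhs (W p))) => //; apply: cinv_cvg; exact: W0.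
  apply: cvg_vec => v; rewrite /hF; case: ifP => _ //; case: ifP => _.
    by apply: cvgB => //; apply: cvg_sumr.
  by apply: cvg_within_filter; exact: cvg_coord.
- move=> p pr; have Qp : Q p by rewrite /Q /= pr.
  have tp : tau p = 0 by rewrite /tau pr mulrC -mulrA mulVf ?mulr1 ?subrr.
  have zp : zeta p = zt p.
    by rewrite /zeta /W tp !mul0r scale0r addr0 cmapK //; exact: cone_zt.
  apply: coordP => v; rewrite FE /hF zp; case: ifPn => [vr|vr]; first by rewrite ztE /h vr.
  case: eqP => [->|//]; rewrite (bigD1 a) ?ar //= big1 => [|u /andP[/andP[ur ub] ua]].
    rewrite addr0 !ztE /h (negbTE ar) (negbTE br) eqxx [b == a]eq_sym (negbTE ab) eqxx.
    by field.
  by rewrite ztE /h (negbTE ur) (negbTE ua) (negbTE ub).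
have Fv v : hF p v = (v \in r)%:R by rewrite -FE Fp indE.
have [cz _] := cinv_cone (W0 p Qp); rewrite -/(zeta p) in cz; have [z0 zD _] := cz.
have zr v : v \in r -> coord (zeta p) v = 1 by move=> vr; have := Fv v; rewrite /hF vr.
(* At most one coordinate of [zeta p] outside [r] is nonzero, and the one at [b] equals the sum of
   the others; so all vanish and [zeta p] is [x]. *)
have [u0 zu0] : exists u, face_of (zeta p) \subset u |: r.
  apply: one_more zD _; apply/fintype.subsetP => v vr.
  by rewrite in_face_of zr // oner_eq0.
have zu v : v \notin r -> v != u0 -> coord (zeta p) v = 0.
  move=> vr vu; apply/eqP/negPn; rewrite -in_face_of; apply/negP => /(fintype.subsetP zu0).
  by rewrite !inE (negbTE vr) orbF (negbTE vu).
have sumE : \sum_(u | (u \notin r) && (u != b)) coord (zeta p) u = coord (zeta p) b.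
  by have := Fv a; rewrite /hF (negbTE ar) eqxx => /eqP; rewrite subr_eq0 => /eqP.
have zb : coord (zeta p) b = 0.
  have [ub|ub] := eqVneq b u0; last exact: zu.
  by rewrite -sumE big1 // => u /andP[ur]; rewrite ub; exact: zu.
have zx : zeta p = x.
  apply: coordP => v; rewrite indE; case vr : (v \in r); first exact: zr.
  have [-> //|vb] := eqVneq v b; move/eqP: sumE; rewrite zb psumr_eq0 => [|u _]; last exact: z0.
  by move/allP => /(_ v); rewrite mem_index_enum vr vb => /(_ isT)/eqP.
have Wx : W p = x0 by rewrite /x0 -zx /zeta cinvK //; exact: W0.
have pv v : v \notin r -> v != a -> coord p v = 0.
  by move=> vr va; have := Fv v; rewrite /hF (negbTE vr) (negbTE va).
have n0 : `|xi p - y| != 0 by rewrite normr_eq0 xi_y.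
have /andP[t0 t1] := tau01 p Qp.
(* Here [x0] is on the ray from [y] through [xi p], so the lengths add up. This puts [p] within 1/8
   of [x], hence [tau p] is at least 3/4 and the push alone exceeds [delta]. *)
have deltaE : `|xi p - y| + tau p * (2 * delta) = delta.
  have E : (1 + tau p * (2 * delta) * `|xi p - y|^-1) *: (xi p - y) = x0 - y.
    by rewrite scalerDl scale1r -Wx /W addrAC.
  move/(congr1 Num.norm): E; rewrite normrZ [RHS]distrC -/delta => E; rewrite -[RHS]E.
  rewrite ger0_norm; last first.
    apply: addr_ge0 => //; apply: mulr_ge0; last by rewrite invr_ge0.
    by apply: mulr_ge0 => //; apply: mulr_ge0 => //; exact: ltW.
  by field.
have td0 : 0 <= tau p * (2 * delta) by apply: mulr_ge0 => //; apply: mulr_ge0 => //; exact: ltW.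
have xi_near : `|xi p - x0| < d2.
  rewrite -(subrKA y) (le_lt_trans (ler_normD _ _)) //; apply: le_lt_trans dd2.
  by rewrite -/delta; lra.
have := d2P _ xi_near; rewrite cmapK; last exact: cone_zt.
move=> zt_near.
have px : `|p - x| <= 1 / 8.
  apply: coord_norm_le => [|v]; first lra.
  have ztv u := le_trans (coord_le (zt p - x) u) (ltW zt_near).
  have [vr|vr] := boolP (v \in r); first by have := ztv v; rewrite !coordB ztE /h vr.
  have [->|va] := eqVneq v a; last by rewrite coordB indE (negbTE vr) pv // subrr normr0; lra.
  have := ztv a; have := ztv b; rewrite !coordB !ztE !indE /h (negbTE ar) (negbTE br) eqxx.
  rewrite [b == a]eq_sym (negbTE ab) eqxx /= !mulr0n !subr0 !ler_norml.
  have [pa|pa] := leP 0 (coord p a).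
    by rewrite ger0_norm // => /andP[h1 h2] /andP[h3 h4]; apply/andP; split; lra.
  by rewrite ltr0_norm // => /andP[h1 h2] /andP[h3 h4]; apply/andP; split; lra.
have tau_ge : 3 / 4 <= tau p by rewrite /tau; lra.
have := normr_ge0 (xi p - y) => xn.
have : 3 / 4 * (2 * delta) <= tau p * (2 * delta).
  by apply: ler_wpM2r => //; apply: mulr_ge0 => //; exact: ltW.
lra.
Qed.

(** For [d = 1] the only ridge is empty and has no relative interior point at which to argue; the
    realization is then just the set of vertices. *)
Lemma zero_dimensional_sphere : (forall v, [set v]%SET \in D) ->
  (forall s : {set V}, s \in D -> (#|s| <= 1)%N) ->
  exists phi : V -> Y, [/\ injective phi, forall v, sphere (phi v) &
    forall y, sphere y -> exists v, phi v = y].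
Proof.
move=> D1 Dle; pose pt v := ind [set v]%SET.
have coord_pt v u : coord (pt v) u = (u == v)%:R by rewrite indE inE.
have real_pt v : realization (pt v).
  split=> [u||]; first by rewrite coord_pt.
  - rewrite (bigD1 v) //= coord_pt eqxx big1 ?addr0 // => u uv.
    by rewrite coord_pt (negbTE uv).
  - by rewrite face_of_ind.
have ptP x : realization x -> exists v, x = pt v.
  move=> [x0 x1 xD]; have [s0|[v vx]] := set_0Vmem (face_of x).
    have : \sum_v coord x v = 0.
      apply: big1 => v _; apply/eqP/negPn; rewrite -in_face_of s0 inE //.
    by rewrite x1 => /eqP; rewrite oner_eq0.
  have xz u : u != v -> coord x u = 0.
    move=> uv; apply/eqP/negPn; rewrite -in_face_of; apply/negP => ux.
    by move: uv; rewrite (card_le1_eqP (Dle _ xD) u v ux vx) eqxx.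
  exists v; apply: coordP => u; rewrite coord_pt; have [->|uv] := eqVneq u v; last exact: xz.
  by move: x1; rewrite (bigD1 v) //= big1 ?addr0 // => w; exact: xz.
have phi_sphere v : sphere (f (pt v)) by apply: fS; exists (pt v).
have phi_inj u v : f (pt u) = f (pt v) -> u = v.
  move=> /(congr1 g); rewrite !fK // => /(congr1 (fun x => coord x u)).
  rewrite !coord_pt eqxx; case: eqP => // _ /eqP.
  by rewrite oner_eq0.
have phi_surj y : sphere y -> exists v, f (pt v) = y.
  move=> ys; have [|v gv] := ptP (g y); first by apply: gD; exists y.
  by exists v; rewrite -gv gK.
by exists (f \o pt); split.
Qed.

End Cone.

(** A sphere of positive dimension would carry [#|V| + 1] points told apart by their first
    coordinate, so only the two points of the 0-sphere remain. *)
Lemma finite_sphere_card (R : realType) (k : nat) (V : finType) (phi : V -> 'rV[R]_k.+1) :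
  injective phi -> (forall v, sphere (phi v)) ->
  (forall y, sphere y -> exists v, phi v = y) -> #|V| = 2%N.
Proof.
case: k phi => [|k'] phi phi_inj phiS phi_surj.
  have row1 (y z : 'rV[R]_1) : y ord0 ord0 = z ord0 ord0 -> y = z.
    by move=> e; apply/rowP => i; rewrite (ord1 i).
  have [vp vpE] : exists v, phi v = const_mx 1.
    by apply: phi_surj; rewrite /sphere /= big_ord1 mxE expr1n.
  have [vm vmE] : exists v, phi v = const_mx (- 1).
    by apply: phi_surj; rewrite /sphere /= big_ord1 mxE sqrrN expr1n.
  have pm : vp != vm.
    apply/eqP => e; move: vpE; rewrite e vmE => /(congr1 (fun y : 'rV[R]_1 => y ord0 ord0)).
    by rewrite !mxE => /eqP; rewrite -subr_eq0 -opprD oppr_eq0 (pnatr_eq0 R 2).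
  rewrite -cardsT (_ : finset.setTfor _ = [set vp; vm]%SET) ?cards2 ?pm //.
  apply/setP => v; rewrite !inE; apply/esym/orP.
  have := phiS v; rewrite /sphere /= big_ord1 => /eqP.
  rewrite sqrf_eq1 => /orP[] /eqP e; [left|right]; apply/eqP/phi_inj/row1.
    by rewrite vpE e mxE.
  by rewrite vmE e mxE.
exfalso; pose y (j : 'I_#|V|.+1) : 'rV[R]_k'.+2 :=
  \row_i (if i == 0%N :> nat then j.+1%:R^-1 else
          if i == 1%N :> nat then Num.sqrt (1 - j.+1%:R^-1 ^+ 2) else 0).
have yS j : sphere (y j).
  rewrite /sphere /= big_ord_recl big_ord_recl big1 => [|i _]; last by rewrite mxE /= expr0n.
  rewrite !mxE /= sqr_sqrtr; first by rewrite addr0 addrC subrK.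
  by rewrite subr_ge0; apply: exprn_ile1; rewrite ?invr_ge0 // invf_le1 ?ltr0n // ler1n.
have /choice[v vE] := fun j => phi_surj (y j) (yS j).
have vinj : injective v.
  move=> i j e; have : y i ord0 ord0 = y j ord0 ord0 by rewrite -!vE e.
  rewrite !mxE /= => /invr_inj/eqP; rewrite eqr_nat eqSS => /eqP; exact: val_inj.
by have := leq_card v vinj; rewrite card_ord ltnn.
Qed.

End Topology.

(** * Reconstruction *)

Section Facets.
Variables (V : finType) (D : {set {set V}}) (d : nat).

Lemma facetsP (F : {set V}) :
  reflect (F \in D /\ forall G, G \in D -> F \subset G -> G = F) (F \in facets D).
Proof.
rewrite finset.in_set; apply: (iffP andP) => -[FD h]; split=> //.
  by move=> G GD FG; move/forall_inP: h => /(_ G GD)/implyP/(_ FG)/eqP.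
by apply/forall_inP => G GD; apply/implyP => FG; rewrite (h G).
Qed.

Lemma face_in_facet (s : {set V}) : s \in D -> exists2 F, F \in facets D & s \subset F.
Proof.
move=> sD; have [F /maxsetP[FD Fmax] sF] := maxset_exists (P := fun t => t \in D) sD.
by exists F => //; apply/facetsP; split=> // G; apply: Fmax.
Qed.

Hypothesis pureD : pure D d.

Lemma facet_card (s : {set V}) : s \in D -> #|s| = d -> s \in facets D.
Proof.
move=> sD sd; have [F FF sF] := face_in_facet sD.
suff -> : s = F by [].
by apply/eqP; rewrite eqEcard sF sd (pureD FF) leqnn.
Qed.

Lemma facet_over (r F : {set V}) : F \in facets D -> r \subset F -> #|r|.+1 = d ->
  exists2 v, v \notin r & F = v |: r.
Proof.
move=> FF rF rd; have /cards1P[v vE] : #|F :\: r| == 1.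
  by rewrite cardsD (finset.setIidPr rF) (pureD FF) -rd subSn ?subnn.
have := finset.set11 v; rewrite -vE finset.in_setD => /andP[vr vF]; exists v => //.
by rewrite -(finset.setID F r) (finset.setIidPr rF) vE finset.setUC.
Qed.

Lemma dim1E (F : {set V}) : F \in facets D -> dim1 D = d.
Proof.
move=> FF; apply/eqP; rewrite eqn_leq; apply/andP; split.
  apply/bigmax_leqP => s sD; have [G GF sG] := face_in_facet sD.
  by rewrite -(pureD GF) subset_leq_card.
by rewrite -(pureD FF) (leq_bigmax_cond (F := fun s : {set V} => #|s|)) //; have /facetsP[] := FF.
Qed.

(** The facets above [r] correspond to the vertices that complete [r] to a face. There is at least
    one, and the topological lemmas exclude exactly one and more than two; the empty ridge is
    treated apart. *)
Lemma ridge_two (r F : {set V}) : simplicial_sphere D -> F \in facets D ->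
  r \subset F -> #|r|.+1 = d -> #|[set G in facets D | r \subset G]| = 2.
Proof.
move=> [[D1 downD] [k [f [g [[fS gD fK gK] [fc gc]]]]]] FF rF rd.
pose E := [set v : V | (v \notin r) && (v |: r \in D)].
have extE G : G \in facets D -> r \subset G -> exists2 v, v \in E & G = v |: r.
  move=> GF rG; have [v vr GE] := facet_over GF rG rd; exists v => //.
  by rewrite finset.in_set vr -GE; have /facetsP[] := GF.
have -> : [set G in facets D | r \subset G] = (fun v => v |: r) @: E.
  apply/finset.setP => G; rewrite finset.in_set; apply/andP/finset.imsetP => [[GF rG]|[v]]; first exact: extE.
  rewrite finset.in_set => /andP[vr vD] ->; rewrite finset.subsetUr; split=> //.
  by apply: facet_card => //; rewrite cardsU1 vr.
rewrite card_in_imset; last first.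
  move=> u v; rewrite !finset.in_set => /andP[ur _] /andP[vr _] /finset.setP/(_ u).
  by rewrite !finset.in_setU !finset.in_set1 eqxx (negbTE ur) /= orbF => /esym/eqP.
have over s : s \in D -> r \subset s -> exists2 v, v \in E & s \subset v |: r.
  move=> sD rs; have [G GF sG] := face_in_facet sD.
  have [v vE GE] := extE G GF (fintype.subset_trans rs sG).
  by exists v; rewrite // -GE.
have [r0|rn0] := eqVneq r finset.set0.
  have [|phi [phi1 phi2 phi3]] := @zero_dimensional_sphere Rdefinitions.R V D k f g fS gD fK gK D1.
    move=> s sD; have [G GF sG] := face_in_facet sD.
    by rewrite (leq_trans (subset_leq_card sG)) // (pureD GF) -rd r0 cards0.
  rewrite -(finite_sphere_card phi1 phi2 phi3); apply: eq_card => v.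
  by rewrite finset.in_set r0 finset.setU0 finset.in_set0 D1.
have [w wE _] := extE F FF rF.
have Eprop v : v \in E -> v \notin r /\ v |: r \in D by rewrite finset.in_set => /andP[].
apply/eqP; rewrite eqn_leq; apply/andP; split; rewrite leqNgt; apply/negP.
  rewrite (cardsD1 w) wE add1n ltnS => E3.
  have /card_gt1P[a [b [aE bE ab]]] := E3.
  have [/finset.setD1P[aw aE'] /finset.setD1P[bw bE']] := (aE, bE).
  have [[wr wD] [ar aD] [br bD]] := And3 (Eprop w wE) (Eprop a aE') (Eprop b bE').
  apply: (@ridge_not_three Rdefinitions.R V D k f g fS gD fK gK fc gc downD r w a b) => //.
  - by rewrite eq_sym.
  - by rewrite eq_sym.
  - by move=> s sD rs; have [v _ sv] := over s sD rs; exists v.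
rewrite (cardsD1 w) wE add1n ltnS ltnS leqn0 cards_eq0 => /eqP E1.
have [wr wD] := Eprop w wE.
apply: (@ridge_not_one Rdefinitions.R V D k f g fS gD fK gK fc gc downD r w) => //.
move=> s sD rs; have [v vE sv] := over s sD rs.
suff -> : w = v by [].
apply/esym/eqP/negPn/negP => vw; have := finset.in_set0 v.
by rewrite -E1 finset.in_setD1 vw vE.
Qed.

End Facets.

(** * From complexes to indexed families of facets *)

Section Enumeration.
Variables (I V : finType) (D : {set {set V}}) (d : nat) (T : I -> {set V}).
Hypotheses (sphD : simplicial_sphere D) (pureD : pure D d) (d0 : 0 < d).
Hypotheses (T_inj : injective T) (T_facets : forall F, F \in facets D <-> exists i, T i = F).

Lemma T_facet i : T i \in facets D.
Proof. by apply/T_facets; exists i. Qed.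

Lemma facets_thin : thin T d.
Proof.
split=> // [i|i r rT rd]; first by rewrite (pureD (T_facet i)).
rewrite -(ridge_two pureD sphD (T_facet i) rT rd) -(card_imset _ T_inj).
apply: eq_card => F; apply/imsetP/idP => [[j]|].
  by rewrite in_star finset.in_set => rj ->; rewrite T_facet.
rewrite finset.in_set => /andP[/T_facets[j <-] rj]; exists j => //.
by rewrite in_star.
Qed.

Lemma fr_adjE i j : fr_adj D (T i) (T j) = adj T d i j.
Proof.
rewrite /fr_adj !T_facet /is_ridge (dim1E pureD (T_facet i)) /adj /=.
have [[_ downD] _] := sphD; have /facetsP[TD _] := T_facet i.
by rewrite (downD _ _ TD (subsetIl _ _)).
Qed.

(** A facet of the intersection complex that contains [T i :&: T j] has [d - 1] vertices by purity
    and lies in an earlier facet, which is therefore adjacent to [T i]. *)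
Lemma facets_shell (s : seq {set V}) : shelling D d s ->
  shell T d (fun i => index (T i) s).
Proof.
move=> [us sE sh] i j ji.
have Ts l : T l \in s by have := T_facet l; rewrite -sE finset.in_set.
have isz : 0 < index (T i) s < size s by rewrite index_mem Ts (leq_ltn_trans _ ji).
have := sh _ isz; rewrite nth_index // => pureI.
have TI : T i :&: T j \in shell_inter (take (index (T i) s) s) (T i).
  rewrite finset.in_set subsetIl /=; apply/hasP; exists (T j); rewrite ?subsetIr //.
  by rewrite in_take ?Ts.
have [G GF TG] := face_in_facet TI; have Gd := pureI G GF.
have /facetsP[] := GF; rewrite finset.in_set => /andP[GT /hasP[U Us GU]] _.
have UD : U \in facets D by rewrite -sE finset.in_set; apply: mem_take Us.
have [k kE] : exists k, T k = U by apply/T_facets.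
subst U; exists k.
have ki : index (T k) s < index (T i) s by rewrite -in_take ?Ts.
split=> //; last exact: fintype.subset_trans TG GU.
apply: (ridge_adj facets_thin (R := G)) => //; first by rewrite Gd prednK.
by apply: contraTneq ki => ->; rewrite ltnn.
Qed.

End Enumeration.

(** In the star of the empty face, which contains every facet, the neighbours of a facet correspond
    to its vertices. Thus the graph determines the dimension. *)
Lemma thin_degree (I V : finType) (T : I -> {set V}) d i : thin T d ->
  #|[set j | adj T d i j]| = d.
Proof.
move=> tT; have [_ cT _] := tT; have i0 : i \in star T finset.set0 by rewrite in_star finset.sub0set.
have := star_nbrs tT i0; rewrite finset.setD0 => e.
transitivity #|nb T i @: T i|; last by rewrite card_in_imset ?cT //; exact: nb_inj tT _.
by rewrite -e; apply: eq_card => j; rewrite !finset.in_set finset.sub0set.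
Qed.

(** The sphere has a point, and barycentric coordinates over an empty vertex set could not sum to
    1. *)
Lemma simplicial_sphere_vertex (V : finType) (D : {set {set V}}) :
  simplicial_sphere D -> exists v : V, [set v]%SET \in D.
Proof.
move=> [[D1 _] [k [f [g [[fS gD fK gK] _]]]]].
pose y : 'rV[RR]_k.+1 := (\row_i (i == ord0)%:R)%R.
have [|_ s1 _] := gD (g y).
  exists y => //; rewrite /euclid_sphere /= (bigD1 ord0) //=.
  rewrite mxE eqxx big1 => [|i /negbTE i0]; first by rewrite GRing.expr1n GRing.addr0.
  by rewrite mxE i0 GRing.expr0n.
have [v|noV] := pickP (@predT V); first by exists v.
move: s1; rewrite big_pred0 // => /eqP; by rewrite eq_sym GRing.oner_eq0.
Qed.

Lemma facet_size_gt0 (V : finType) (D : {set {set V}}) d :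
  simplicial_sphere D -> pure D d -> 0 < d.
Proof.
move=> /simplicial_sphere_vertex[v vD] pD; have [F FF vF] := face_in_facet vD.
by rewrite -(pD F FF) (leq_trans _ (subset_leq_card vF)) // cards1.
Qed.

Theorem theorem1p2 (V V' : finType) (D : {set {set V}}) (D' : {set {set V'}}) :
  simplicial_sphere D -> shellable D ->
  simplicial_sphere D' -> shellable D' ->
  fr_graph_iso D D' ->
  complex_iso D D'.
Proof.
move=> sph [d [pD [s sh]]] sph' [d' [pD' [s' sh']]] [phi [phi_inj phi_im phi_adj]].
have [us sE _] := sh; have d0 := facet_size_gt0 sph pD; have d0' := facet_size_gt0 sph' pD'.
(* Listing the facets of [D'] through [phi] puts both graphs on the same index set. *)
pose T (i : 'I_(size s)) := nth finset.set0 s i; pose T' i := phi (T i).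
have T_inj : injective T by move=> i j /eqP; rewrite nth_uniq // => /eqP/val_inj.
have T_facets F : F \in facets D <-> exists i, T i = F.
  rewrite -sE finset.in_set; split=> [Fs|[i <-]]; last exact: mem_nth.
  have iF : index F s < size s by rewrite index_mem.
  by exists (Ordinal iF); rewrite /T nth_index.
have TF i : T i \in facets D by apply/T_facets; exists i.
have T'_inj : injective T' by move=> i j /(phi_inj _ _ (TF i) (TF j))/T_inj.
have T'_facets F : F \in facets D' <-> exists i, T' i = F.
  rewrite -phi_im; split=> [/imsetP[G /T_facets[i <-] ->]|[i <-]]; first by exists i.
  by apply: imset_f.
have tT := facets_thin sph pD T_inj T_facets.
have tT' := facets_thin sph' pD' T'_inj T'_facets.
have adjE i j : adj T d i j = adj T' d' i j.
  by rewrite -(fr_adjE sph pD T_facets) -(fr_adjE sph' pD' T'_facets) phi_adj.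
have [v0 v0D] := simplicial_sphere_vertex sph.
have [F0 /T_facets[i0 _] _] := face_in_facet v0D.
have dd' : d' = d.
  rewrite -(thin_degree i0 tT) -(thin_degree i0 tT').
  by apply: eq_card => j; rewrite !finset.in_set adjE.
subst d'.
have cover v : exists i, v \in T i.
  have [[D1 _] _] := sph; have [F /T_facets[i <-] vF] := face_in_facet (D1 v).
  by exists i; rewrite -finset.sub1set.
have cover' v : exists i, v \in T' i.
  have [[D1 _] _] := sph'; have [F /T'_facets[i <-] vF] := face_in_facet (D1 v).
  by exists i; rewrite -finset.sub1set.
have ord_inj (W : finType) (S : 'I_(size s) -> {set W}) (E : {set {set W}}) (t : seq {set W}) :
    injective S -> (forall F, F \in facets E <-> exists i, S i = F) -> shelling E d t ->
    injective (fun i => index (S i) t).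
  move=> Si SF [_ tE _] i j e; apply: Si.
  have St l : S l \in t by have : S l \in facets E by [apply/SF; exists l]; rewrite -tE finset.in_set.
  by rewrite -(nth_index finset.set0 (St i)) e nth_index.
have [f [f_bij fT]] := thin_shell_iso tT tT' adjE (ord_inj _ _ _ _ T_inj T_facets sh)
  (ord_inj _ _ _ _ T'_inj T'_facets sh') (facets_shell sph pD d0 T_inj T_facets sh)
  (facets_shell sph' pD' d0' T'_inj T'_facets sh') cover cover'.
(* Faces are the subsets of facets, so it is enough that [f] maps facets to facets. *)
exists f; split=> // t; split=> [tD|ftD].
  have [F /T_facets[i <-] tF] := face_in_facet tD.
  have [[_ downD'] _] := sph'; apply: (downD' (T' i)); last by rewrite -fT imsetS.
  by have /facetsP[] : T' i \in facets D' by apply/T'_facets; exists i.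
have [F /T'_facets[i <-] tF] := face_in_facet ftD.
have [[_ downD] _] := sph; apply: (downD (T i)); first by have /facetsP[] := TF i.
apply/fintype.subsetP => v vt.
have : f v \in f @: T i by rewrite fT (fintype.subsetP tF) // imset_f.
by case/imsetP => u uT /(bij_inj f_bij) ->.
Qed.
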